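(* For any positive integer $r$, there exist constants $q$ and $m$ such that for all $n\geq m$, the following holds. If $G$ is a graph on $2n$ vertices which has a bipartite subgraph $H=(U,V)$ with $|U|=|V|=n$ and $\delta(H)\geq \frac n2+q$, then $$\chi(\mathrm{KG}(G,rK_2))=\zeta(\mathrm{KG}(G,rK_2))=|E(G)|-\mathrm{ex}(G,rK_2).$$
   Context: All graphs and hypergraphs are finite and simple; $\delta(H)$ is the minimum degree and $\chi$ the chromatic number (equal to $0$ for the graph with no vertices). $H=(U,V)$ means that $H$ is bipartite with parts $U$ and $V$. $rK_2$ is a matching of size $r$. Matching graph and Turán number: $\mathrm{KG}(G,rK_2)$ is the graph whose vertices are all matchings of size $r$ in $G$ (subgraphs isomorphic to $rK_2$), two being adjacent if they are edge-disjoint. $\mathrm{ex}(G,rK_2)$ is the maximum number of edges of a spanning subgraph of $G$ containing no subgraph isomorphic to $rK_2$. Altermatic number: for $X\in\{-1,0,+1\}^N$, $alt(X)$ is the length of a longest subsequence of nonzero terms of $X$ in which any two consecutive terms are different ($alt(0)=0$). For a hypergraph $\mathcal{H}$ (hyperedges are nonempty sets) with $|V(\mathcal{H})|=N$ and a linear ordering $\sigma=(\sigma(1),\ldots,\sigma(N))$ of $V(\mathcal{H})$, put $X^+_\sigma=\{\sigma(j): x_j=+1\}$ and $X^-_\sigma=\{\sigma(j): x_j=-1\}$. $alt_\sigma(\mathcal{H})$ is the largest $k$ for which there is an $X\in\{-1,0,+1\}^N$ with $alt(X)=k$ such that neither $X^+_\sigma$ nor $X^-_\sigma$ contains a hyperedge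 of $\mathcal{H}$; $alt(\mathcal{H})=\min_\sigma alt_\sigma(\mathcal{H})$. $\mathrm{KG}(\mathcal{H})$ is the graph whose vertices are the hyperedges of $\mathcal{H}$, two being adjacent if they are disjoint. The altermatic number of a graph $F$ is $\zeta(F)=\max_{\mathcal{H}}\{|V(\mathcal{H})|-alt(\mathcal{H})\}$, over all hypergraphs $\mathcal{H}$ such that $\mathrm{KG}(\mathcal{H})$ and $F$ are homomorphically equivalent (there are graph homomorphisms in both directions). *)

(* Defs.v *)
From mathcomp Require Import all_boot all_order all_algebra.

Set Implicit Arguments.
Unset Strict Implicit.
Unset Printing Implicit Defensive.

(* A finite simple graph with vertex set T. *)
Record graph (T : finType) := Graph {
  adj :> rel T;
  adj_sym : symmetric adj;
  adj_irrefl : irreflexive adj }.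

(* Hypergraphs carry their vertex set, so that one can quantify over all of
   them; isolated vertices are allowed. *)
Record hypergraph := Hypergraph {
  hvertex : finType;
  hyperedges : {set {set hvertex}};
  hyperedges_neq0 : set0 \notin hyperedges }.

Section Graphs.
Variable T : finType.
Implicit Types (G H : graph T) (F M : {set {set T}}) (U V : {set T}).

Definition edge_set G : {set {set T}} :=
  [set [set p.1; p.2] | p : T * T & G p.1 p.2].

(* A subgraph H = (U, V) of G with |U| + |V| = |V(G)| has the same vertex set as
   G, so spanning subgraphs are sufficient here. *)
Definition subgraph H G := subrel H G.

Definition bipartition H U V :=
  [/\ U :|: V = [set: T], [disjoint U & V]
    & forall x y, H x y ->
        (x \in U /\ y \in V) \/ (x \in V /\ y \in U)].

Definition degree G (x : T) := #|[set y | G x y]|.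

(* Degrees are smaller than #|T|, so the default value of the iterated minimum
   is only reached when T is empty (and is then 0). *)
Definition min_degree G := \big[minn/#|T|]_(x : T) degree G x.

Definition colorable G k :=
  [exists c : {ffun T -> 'I_k}, forall x, forall y, G x y ==> (c x != c y)].

Lemma colorable_card G : exists k, colorable G k.
Proof.
exists #|T|; apply/existsP; exists (finfun enum_rank).
apply/forallP=> x; apply/forallP=> y; apply/implyP=> xy.
rewrite !ffunE (inj_eq enum_rank_inj); apply: contraTneq xy => ->.
by rewrite adj_irrefl.
Qed.

Definition chromatic_number G := ex_minn (colorable_card G).

(* The copies of r K_2 inside a set of edges F. *)
Definition matchings r F : {set {set {set T}}} :=
  [set M : {set {set T}} | [&& M \subset F, trivIset M & #|M| == r]].

(* ex(G, r K_2); a spanning subgraph is identified with its set of edges. *)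
Definition turan_matching G r :=
  \max_(F : {set {set T}} | (F \subset edge_set G) && (matchings r F == set0))
     #|F|.

Section MatchingGraph.
Variables (G : graph T) (r : nat).

Definition matching_in := {M : {set {set T}} | M \in matchings r (edge_set G)}.

Definition matching_adj : rel matching_in :=
  fun A B => (A != B) && [disjoint val A & val B].

Lemma matching_adj_sym : symmetric matching_adj.
Proof. by move=> A B; rewrite /matching_adj eq_sym disjoint_sym. Qed.

Lemma matching_adj_irrefl : irreflexive matching_adj.
Proof. by move=> A; rewrite /matching_adj eqxx. Qed.

(* KG(G, r K_2) *)
Definition matching_graph := Graph matching_adj_sym matching_adj_irrefl.

End MatchingGraph.
End Graphs.

Definition homomorphic (T1 T2 : finType) (F1 : graph T1) (F2 : graph T2) :=
  exists f : T1 -> T2, forall x y, F1 x y -> F2 (f x) (f y).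

Definition hom_equivalent (T1 T2 : finType) (F1 : graph T1) (F2 : graph T2) :=
  homomorphic F1 F2 /\ homomorphic F2 F1.

Section Kneser.
Variable H : hypergraph.

Definition hyperedge := {A : {set hvertex H} | A \in hyperedges H}.

Definition kneser_adj : rel hyperedge := fun A B => [disjoint val A & val B].

Lemma kneser_adj_sym : symmetric kneser_adj.
Proof. by move=> A B; rewrite /kneser_adj disjoint_sym. Qed.

Lemma kneser_adj_irrefl : irreflexive kneser_adj.
Proof.
move=> [A HA]; apply/negbTE; rewrite /kneser_adj /= -setI_eq0 setIid.
by apply: contraNneq (hyperedges_neq0 H) => <-.
Qed.

Definition kneser := Graph kneser_adj_sym kneser_adj_irrefl.

End Kneser.

(* Signs: Some true is +1, Some false is -1 and None is 0. *)
Definition sign := option bool.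

Definition alternating (s : seq sign) :=
  (None \notin s) && sorted (fun a b => a != b) s.

(* alt(X): the subsequences of X are the sequences mask m X. *)
Definition alt_signs (X : seq sign) :=
  \max_(m : (size X).-tuple bool | alternating (mask m X)) size (mask m X).

Section Altermatic.
Variable H : hypergraph.
Local Notation T := (hvertex H).
Local Notation N := #|{: T}|.

(* The set of the s_j with X_j = a. *)
Definition sign_class (s : N.-tuple T) (X : N.-tuple sign) (a : sign) : {set T} :=
  [set tnth s j | j : 'I_N & tnth X j == a].

Definition edge_free (A : {set T}) :=
  [forall B in hyperedges H, ~~ (B \subset A)].

(* alt_s(H); the vector X = 0 is always admissible. *)
Definition alt_ordering (s : N.-tuple T) :=
  \max_(X : N.-tuple sign | edge_free (sign_class s X (Some true))
                         && edge_free (sign_class s X (Some false)))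
     alt_signs X.

(* A linear ordering is a duplicate-free N.-tuple. Every alt_ordering s is at
   most N, so the default value does not affect the minimum. *)
Definition alt_hypergraph := \big[minn/N]_(s : N.-tuple T | uniq s) alt_ordering s.

(* alt_hypergraph <= N, so the subtraction is not truncated. *)
Definition altermatic_bound := N - alt_hypergraph.

End Altermatic.

(* z = zeta(F), i.e. z is the maximum of |V(H)| - alt(H) over all hypergraphs H
   with KG(H) homomorphically equivalent to F; as H ranges over an infinite
   class, the maximum is expressed as a relation. *)
Definition is_altermatic_number (T : finType) (F : graph T) (z : nat) :=
  (exists2 H : hypergraph, hom_equivalent (kneser H) F
                         & altermatic_bound H = z) /\
  (forall H : hypergraph, hom_equivalent (kneser H) F ->
                          altermatic_bound H <= z).

(* Main.v *)
Require Import Defs.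
From mathcomp Require Import all_boot all_order all_algebra.
From mathcomp Require Import perm zify.

Set Implicit Arguments.
Unset Strict Implicit.
Unset Printing Implicit Defensive.

(** Write E for the edge set of G and ex for the largest number of edges without
    r disjoint ones.  A set F of ex such edges gives a proper colouring of the
    matching graph with #|E| - ex colours: every r-matching has an edge outside
    F, and disjoint matchings receive distinct edges
    ([matching_graph_colorable]).

    In the other direction, if KG(H) is properly k-coloured, then for every
    ordering of the N vertices of H some sign vector with at least N - k
    alternations has no hyperedge on either side ([kneser_lower_bound]).  This is
    the topological input: a sign vector is labelled by its alternation length if
    it has no hyperedge on either side, and by a colour otherwise, and Tucker's
    lemma ([octahedral_tucker]) bounds the number of labels from below.  Tucker's
    lemma is itself a parity count of maximal chains of sign vectors whose labels
    alternate in sign.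

    So the chromatic number, the altermatic number and #|E| - ex all agree once
    E has an ordering in which two disjoint sets P, M of edges, both without r
    disjoint edges and alternating along the ordering, have together at most ex
    elements.  Such a P is a union of stars at fewer than r hubs, up to a bounded
    number of edges for each missing hub ([matching_free_structure]).  Edges at
    the common hubs C of P and M are harmless, as fewer than r vertices touch at
    most ex edges.  What has to be shown is that the rest of P is at most half of
    what C can gain by adding vertices, and symmetrically for M
    ([avoiding_bound]).  This holds if each hub v of P that is not a hub of M has
    its degree in P below half of its degree in G by a margin exceeding all
    bounded errors.

    The ordering lists the edges along walks.  A walk enters and leaves v by
    consecutive edges, of which alternation allows only one in P, so that half
    the degree is an upper bound up to the ends of the walks; a decomposition
    into trails has at most two ends at each vertex ([trail_decomposition]).  The
    margin comes from flowers: closed walks formed of many 4-cycles through v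
    that meet only in v, all the flowers being edge-disjoint.  Between two edges
    of P there is an edge of M, which with boundedly many exceptions touches one
    of the few hubs of M, and a hub other than v has at most two edges in the
    flower of v.  Hence P contains
    only boundedly many edges of that flower ([alternating_ordering]).  Degrees at
    least a quarter of the number of vertices leave room to choose the flowers
    greedily ([flower_packing]). *)

(** * Tucker's lemma for the cross-polytope *)

(** Parity form of the principle that a fixed-point-free involution pairs up the
    elements of a finite set. *)
Lemma big_addb_involution (I : finType) (P F : pred I) (h : I -> I) :
    involutive h -> (forall x, P (h x) = P x) ->
    (forall x, P x -> F (h x) = F x) -> (forall x, P x -> h x != x) ->
  \big[addb/false]_(x | P x) F x = false.
Proof.
move=> hK hP hF hneq.
pose lt x := enum_rank x < enum_rank (h x).
rewrite (bigID lt) /= [X in _ (+) X](reindex_inj (inv_inj hK)) /=.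
rewrite [X in _ (+) X](eq_big (fun x => P x && lt x) F) ?addbb // => x.
  rewrite hP; case: (boolP (P x)) => //= Px.
  rewrite /lt hK -leqNgt leq_eqVlt orb_idl // => /eqP/val_inj/enum_rank_inj.
  by move/esym/eqP; rewrite (negbTE (hneq _ Px)).
by rewrite hP => /andP[Px _]; apply: hF.
Qed.

(** The labels -m, ..., -1, 1, ..., m are encoded as naturals below 2 * m: the half
    is the absolute value minus one and the parity is the sign. *)
Definition opp_label l := ~~ odd l + l./2.*2.

Fixpoint alternates b (s : seq nat) :=
  if s is l :: s' then (odd l == b) && alternates (~~ b) s' else true.

Lemma odd_opp_label l : odd (opp_label l) = ~~ odd l.
Proof. by rewrite oddD odd_double addbF oddb. Qed.

Lemma opp_labelK : involutive opp_label.
Proof.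
move=> l; rewrite /opp_label oddD odd_double addbF oddb negbK.
by rewrite half_bit_double odd_double_half.
Qed.

(** Reversing signs keeps a list of labels sorted as long as it contains no two
    opposite labels; ties are then genuine repetitions. *)
Lemma leq_opp_label x y : x <= y -> y != opp_label x ->
  opp_label x <= opp_label y.
Proof.
move=> xy; rewrite /opp_label -{1}[y]odd_double_half.
have : x./2 <= y./2 by apply: half_leq.
rewrite leq_eqVlt => /orP[/eqP e|lt _]; last first.
  by case: (odd x) (odd y) => [] []; lia.
rewrite e eqn_add2r leq_add2r; move: xy.
rewrite -[x]odd_double_half -[y]odd_double_half e leq_add2r.
rewrite !oddD !odd_double !addbF !oddb.
by case: (odd x) (odd y) => [] [].
Qed.

Lemma alternates_map_opp b s :
  alternates b (map opp_label s) = alternates (~~ b) s.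
Proof.
elim: s b => //= l s IHs b; rewrite IHs odd_opp_label.
by case: (odd l) b => [] [].
Qed.

(** The engine of the parity argument.  Read on simplices, it says that modulo 2
    the facets whose labels alternate starting with sign b are counted by the
    simplex alternating itself, with either starting sign: an alternating simplex
    has one such facet, any other has none or two. *)
Lemma alternates_rem b s : sorted leq s ->
  \big[addb/false]_(l <- s) alternates b (rem l s)
    = alternates b s (+) alternates (~~ b) s.
Proof.
elim: s b => [|x s IHs] b; first by rewrite big_nil.
move=> xs /=; have ss := path_sorted xs.
rewrite big_cons eqxx.
have -> : \big[addb/false]_(l <- s)
           alternates b (if x == l then s else x :: rem l s)
        = (odd x == b) && \big[addb/false]_(l <- s) alternates (~~ b) (rem l s).
  case: (odd x == b) /eqP => /= odd_x; last first.
    rewrite big1_seq // => l /andP[_ ls].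
    case: eqP => [eq_xl | _] /=; last by case: eqP odd_x.
    case: s {IHs ss} xs ls => // y s /= /andP[xy ys]; rewrite -eq_xl inE.
    case/orP=> [/eqP <-|xs]; first by case: eqP odd_x.
    have /allP/(_ x xs) yx := order_path_min leq_trans ys.
    have <- : x = y by apply/eqP; rewrite eqn_leq xy yx.
    by case: eqP odd_x.
  apply: eq_big_seq => l ls; case: eqP => [eq_xl | _] /=; last by rewrite odd_x eqxx.
  case: s {IHs ss} xs ls => // y s /= /andP[xy ys]; rewrite -eq_xl inE => ls.
  have <- : x = y.
    case/orP: ls => [/eqP //|xs].
    have /allP/(_ x xs) yx := order_path_min leq_trans ys.
    by apply/eqP; rewrite eqn_leq xy yx.
  by rewrite eqxx /= odd_x eqxx.
rewrite (IHs _ ss).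
case: (odd x) (b) => [] [] /=; rewrite ?negbK ?addbF //.
all: by case: (alternates true s); case: (alternates false s).
Qed.

Section Tucker.
Variables (n m : nat) (lab : {set 'I_n * bool} -> nat).

(** A vector in {-1, 0, 1}^n is the set of its signed nonzero coordinates. *)
Definition consistent (Z : {set 'I_n * bool}) := {in Z &, injective fst}.
Definition opp_set (Z : {set 'I_n * bool}) := [set (x.1, ~~ x.2) | x in Z].

Hypothesis lab_opp : forall Z, Z != set0 -> consistent Z ->
  lab (opp_set Z) = opp_label (lab Z).
Hypothesis lab_compl : forall Z Z', Z != set0 -> consistent Z' -> Z \subset Z' ->
  lab Z' != opp_label (lab Z).
Hypothesis lab_lt : forall Z, Z != set0 -> consistent Z -> (lab Z)./2 < m.

Implicit Type w : {ffun 'I_n -> 'I_n * bool}.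

(** A word w lists the coordinates in some order with signs; it stands for the
    maximal chain of sign vectors formed by its prefixes [face w 1], [face w 2],
    and so on. *)
Definition face w k := w @: [set j : 'I_n | j < k].
Definition label w k := lab (face w k.+1).
Definition alt_flag b d w := alternates b (sort leq [seq label w k | k <- iota 0 d]).

(** The maximal chains of the cross-polytope in the first d coordinates.  Keeping
    them in the type of full words, with a fixed tail, makes the passage from d
    to d.+1 free of reindexing. *)
Definition signed_perm d w :=
  injectiveb (fun i => (w i).1) && [forall i : 'I_n, (d <= i) ==> (w i == (i, true))].

Lemma signed_permP d w :
  reflect (injective (fun i => (w i).1) /\ forall i : 'I_n, d <= i -> w i = (i, true))
          (signed_perm d w).
Proof.
apply: (iffP andP) => [[/injectiveP ? /forallP ww]|[? ww]]; split=> //.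
- by move=> i di; apply/eqP; have /implyP := ww i; apply.
- exact/injectiveP.
by apply/forallP=> i; apply/implyP=> /ww/eqP.
Qed.

Lemma face_consistent d w k : signed_perm d w -> consistent (face w k).
Proof.
case/signed_permP=> w_inj _ x y /imsetP[i _ ->] /imsetP[j _ ->] /= eq_ij.
by rewrite (w_inj _ _ eq_ij).
Qed.

Lemma face_neq0 w k : k < n -> face w k.+1 != set0.
Proof.
move=> kn; apply/set0Pn; exists (w (Ordinal kn)).
by apply: imset_f; rewrite inE.
Qed.

Lemma face_subset w j k : j <= k -> face w j \subset face w k.
Proof.
by move=> jk; apply: imsetS; apply/subsetP=> i; rewrite !inE => /leq_trans; apply.
Qed.

Lemma eq_face w w' k : (forall i : 'I_n, i < k -> w i = w' i) -> face w k = face w' k.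
Proof. by move=> ww'; apply: eq_in_imset => i; rewrite inE => /ww'. Qed.

Lemma label_no_opp d w j k : signed_perm d w -> j < n -> k < n ->
  label w k != opp_label (label w j).
Proof.
move=> wd jn kn; case: (leqP j k) => jk.
  apply: lab_compl; [exact: face_neq0 | exact: face_consistent wd|].
  exact: face_subset.
apply: contra_neq (@lab_compl (face w k.+1) (face w j.+1) _ _ _).
- by rewrite -/(label w k) -/(label w j) => ->; rewrite opp_labelK.
- exact: face_neq0.
- exact: face_consistent wd.
by apply: face_subset; apply: ltnW.
Qed.

Definition opp_word d w : {ffun 'I_n -> 'I_n * bool} :=
  [ffun i : 'I_n => if i < d then ((w i).1, ~~ (w i).2) else w i].

Lemma opp_wordK d : involutive (opp_word d).
Proof.
by move=> w; apply/ffunP=> i; rewrite !ffunE; case: (i < d) => //=; rewrite negbK; case: (w i).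
Qed.

Lemma opp_word_perm d w : signed_perm d (opp_word d w) = signed_perm d w.
Proof.
have imp v : signed_perm d v -> signed_perm d (opp_word d v).
  case/signed_permP=> v_inj v_id; apply/signed_permP; split=> [i j|i di].
    have E l : (opp_word d v l).1 = (v l).1 by rewrite ffunE; case: ifP.
    by rewrite !E => /v_inj.
  by rewrite ffunE ltnNge di v_id.
by apply/idP/idP => /imp //; rewrite opp_wordK.
Qed.

Lemma label_opp_word d w k : d <= n -> signed_perm d w -> k < d ->
  label (opp_word d w) k = opp_label (label w k).
Proof.
move=> dn wd kd; rewrite -lab_opp; last exact: face_consistent wd; last first.
  by apply: face_neq0; apply: leq_trans dn.
congr lab; rewrite /opp_set -imset_comp; apply: eq_in_imset => i.
by rewrite inE ltnS => ik; rewrite ffunE /= (leq_ltn_trans ik kd).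
Qed.

Lemma alt_flag_opp b d w : d <= n -> signed_perm d w ->
  alt_flag b d (opp_word d w) = alt_flag (~~ b) d w.
Proof.
move=> dn wd; rewrite /alt_flag -alternates_map_opp.
congr (alternates b _).
pose L := [seq label w k | k <- iota 0 d].
have -> : [seq label (opp_word d w) k | k <- iota 0 d] = map opp_label L.
  rewrite -map_comp; apply/eq_in_map => k; rewrite mem_iota => /andP[_ kd].
  exact: label_opp_word.
apply: (sorted_eq leq_trans anti_leq).
- exact: (sort_sorted leq_total).
- rewrite sorted_map; apply: (@sub_in_sorted _ (mem (sort leq L)) leq) (sort_sorted leq_total L).
    move=> a b'; rewrite /= !mem_sort => /mapP[j]; rewrite mem_iota => /andP[_ jd] ->.
    case/mapP=> k; rewrite mem_iota => /andP[_ kd] -> le_jk.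
    have := @label_no_opp d w j k wd (leq_trans jd dn) (leq_trans kd dn).
    exact: leq_opp_label.
  exact/allP.
rewrite perm_sort; apply: perm_map; by rewrite perm_sym perm_sort.
Qed.

(** Swapping the letters at positions k and k.+1 changes only the (k.+1)-st vector of
    the chain. *)
Definition swap_word (i j : 'I_n) w : {ffun 'I_n -> 'I_n * bool} :=
  [ffun l => w (tperm i j l)].

Lemma swap_wordK i j : involutive (swap_word i j).
Proof. by move=> w; apply/ffunP=> l; rewrite !ffunE tpermK. Qed.

Lemma swap_word_perm d (i j : 'I_n) w : i < d -> j < d ->
  signed_perm d (swap_word i j w) = signed_perm d w.
Proof.
move=> id jd.
have imp v : signed_perm d v -> signed_perm d (swap_word i j v).
  case/signed_permP=> v_inj v_id; apply/signed_permP; split=> [k l|k dk].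
    by rewrite !ffunE => /v_inj/perm_inj.
  rewrite ffunE tpermD ?v_id //; apply: contraTneq dk => <-; rewrite -ltnNge //.
by apply/idP/idP => /imp //; rewrite swap_wordK.
Qed.

Lemma face_swap_word (i j : 'I_n) w k : (i < k) = (j < k) ->
  face (swap_word i j w) k = face w k.
Proof.
move=> ij; apply/setP=> x; apply/imsetP/imsetP=> [] [l].
  rewrite inE ffunE => lk ->; exists (tperm i j l) => //; rewrite inE.
  by case: tpermP lk => // ->; rewrite ij.
rewrite inE => lk ->; exists (tperm i j l); rewrite ?ffunE ?tpermK // inE.
by case: tpermP lk => // ->; rewrite ij.
Qed.

(** Changing the sign of the last letter changes only the last vector of the chain. *)
Definition flip_word (i : 'I_n) w : {ffun 'I_n -> 'I_n * bool} :=
  [ffun l => if l == i then ((w l).1, ~~ (w l).2) else w l].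

Lemma flip_wordK i : involutive (flip_word i).
Proof.
by move=> w; apply/ffunP=> l; rewrite !ffunE; case: (l == i) => //=; rewrite negbK; case: (w l).
Qed.

Lemma flip_word_perm d (i : 'I_n) w : i < d ->
  signed_perm d (flip_word i w) = signed_perm d w.
Proof.
move=> id.
have imp v : signed_perm d v -> signed_perm d (flip_word i v).
  case/signed_permP=> v_inj v_id; apply/signed_permP; split=> [k l|k dk].
    have E a : (flip_word i v a).1 = (v a).1 by rewrite ffunE; case: ifP.
    by rewrite !E => /v_inj.
  by rewrite ffunE; case: eqP dk => [-> | _ /v_id //]; rewrite leqNgt id.
by apply/idP/idP => /imp //; rewrite flip_wordK.
Qed.

Lemma alt_flag_facets d w :
  alt_flag true d w (+) alt_flag false d w
    = \big[addb/false]_(k <- iota 0 d)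
         alternates true (sort leq [seq label w j | j <- rem k (iota 0 d)]).
Proof.
rewrite -[false]/(~~ true) -alternates_rem; last exact: (sort_sorted leq_total).
set L := [seq label w k | k <- iota 0 d].
rewrite (perm_big L) /=; last by rewrite perm_sort.
rewrite big_map; apply: eq_big_seq => k kd.
congr (alternates true _); apply: (sorted_eq leq_trans anti_leq).
- apply: subseq_sorted (rem_subseq _ _) (sort_sorted leq_total L); exact: leq_trans.
- exact: (sort_sorted leq_total).
rewrite perm_sym perm_sort -(perm_cons (label w k)).
have -> : label w k :: [seq label w j | j <- rem k (iota 0 d)]
        = [seq label w j | j <- k :: rem k (iota 0 d)] by [].
have LP : label w k \in sort leq L by rewrite mem_sort map_f.
rewrite (permPr (_ : perm_eq (label w k :: _) (sort leq L))); last first.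
  by rewrite perm_sym; apply: perm_to_rem.
rewrite perm_sym perm_sort; apply: perm_map; exact: perm_to_rem.
Qed.

(** Dimension step, modulo 2.  By antipodality the chains alternating from + are
    as many as the chains of the upper hemisphere (those containing +d)
    alternating from + or from -.  By [alternates_rem] these are as many as the
    incidences of an upper chain with an alternating facet.  Facets interior to
    the hemisphere lie in two upper chains, and the others are exactly the
    alternating chains of the equator. *)
Lemma alt_flag_step d : d < n ->
  \big[addb/false]_(w | signed_perm d.+1 w) alt_flag true d.+1 w
    = \big[addb/false]_(w | signed_perm d w) alt_flag true d w.
Proof.
move=> dn; pose od := Ordinal dn.
pose upper w := [exists j, w j == (od, true)].
have has_d w : signed_perm d.+1 w -> exists2 j : 'I_n, j <= d & (w j).1 = od.
  case/signed_permP=> w_inj w_id.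
  have [g _ gK] := injF_bij w_inj; exists (g od) => //.
  rewrite leqNgt; apply/negP=> gd; have := congr1 val (gK od).
  by rewrite (w_id _ gd) /= => E; rewrite E ltnn in gd.
have upper_opp w : signed_perm d.+1 w -> upper (opp_word d.+1 w) = ~~ upper w.
  move=> wd; have [j jd wj] := has_d w wd; have [w_inj _] := signed_permP _ _ wd.
  have uE v b : (v j).1 = od -> injective (fun i => (v i).1) ->
      [exists i, v i == (od, b)] = ((v j).2 == b).
    move=> vj v_inj; apply/existsP/eqP=> [[i /eqP vi]|<-]; last first.
      by exists j; rewrite -vj -surjective_pairing.
    by have -> : j = i by [apply: v_inj; rewrite /= vi vj]; rewrite vi.
  have [v_inj _] := signed_permP _ _ (etrans (opp_word_perm _ _) wd).
  rewrite /upper !uE // ?ffunE ltnS jd //=; by case: (w j).2.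
rewrite (bigID upper) /= [X in _ (+) X](reindex_inj (inv_inj (opp_wordK d.+1))) /=.
rewrite [X in _ (+) X](eq_big (fun w => signed_perm d.+1 w && upper w)
                              (alt_flag false d.+1)); first last.
- by move=> w /andP[]; rewrite opp_word_perm => wd _; rewrite alt_flag_opp.
- move=> w; rewrite opp_word_perm; case: (boolP (signed_perm _ w)) => //= wd.
  by rewrite upper_opp // negbK.
rewrite -big_split /= (eq_bigr _ (fun w _ => alt_flag_facets d.+1 w)) exchange_big.
have iotaE : iota 0 d.+1 = rcons (iota 0 d) d by rewrite -addn1 iotaD cats1.
have last_facet w :
    alternates true (sort leq [seq label w j | j <- rem d (iota 0 d.+1)]) = alt_flag true d w.
  congr (alternates true (sort leq (map _ _))).
  rewrite rem_filter ?iota_uniq // iotaE filter_rcons /= eqxx /=.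
  by apply/all_filterP/allP=> j; rewrite mem_iota /= => /ltn_eqF->.
(* A facet missing an inner vector of the chain is shared by a chain and its swap. *)
rewrite {1}iotaE big_rcons big1_seq ?addbF => [|k]; last first.
  rewrite andTb mem_iota add0n => /andP[_ kd]; have kn : k < n by lia.
  have k1n : k.+1 < n by apply: leq_ltn_trans (dn).
  pose i := Ordinal kn; pose j := Ordinal k1n.
  apply: (@big_addb_involution _ _ _ (swap_word i j) (swap_wordK i j)).
  - move=> w; rewrite swap_word_perm //=; last exact: leqW; congr andb.
    apply/existsP/existsP=> [] [l]; rewrite ?ffunE => wl; exists (tperm i j l) => //.
    by rewrite ffunE tpermK.
  - move=> w _; congr (alternates true (sort leq _)); apply/eq_in_map => l.
    rewrite rem_filter ?iota_uniq // mem_filter => /andP[/= lk _].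
    rewrite /label face_swap_word //= !ltnS; move: lk; lia.
  move=> w /andP[/signed_permP[w_inj _] _]; apply/eqP=> /ffunP/(_ i).
  rewrite ffunE tpermL => wij; have /(congr1 val) /= := w_inj j i (congr1 fst wij).
  lia.
(* A facet missing the last vector is shared by a chain and its flip, unless the
   last letter is +d: it then lies in the equator. *)
rewrite (eq_bigr _ (fun w _ => last_facet w)) (bigID (fun w => (w od).1 == od)) /=.
rewrite [X in _ (+) X](@big_addb_involution _ _ _ (flip_word od) (flip_wordK od)) ?addbF.
- apply: eq_bigl => w; apply/idP/idP.
    case/andP=> /andP[wd /existsP[j /eqP wj]] /eqP w_od.
    have [w_inj w_id] := signed_permP _ _ wd; apply/signed_permP; split=> // i.
    rewrite leq_eqVlt => /orP[/eqP di | /w_id //].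
    have -> : i = od by apply/val_inj.
    have oj : od = j by apply: w_inj; rewrite /= w_od wj.
    rewrite {1}oj wj; congr (_, _); exact: val_inj.
  case/signed_permP=> w_inj w_id; have w_od := w_id od (leqnn d); rewrite w_od eqxx andbT.
  apply/andP; split; last by apply/existsP; exists od; rewrite w_od.
  by apply/signed_permP; split=> // i /ltnW/w_id.
- move=> w; have imp v : (signed_perm d.+1 v && upper v) && ((v od).1 != od) ->
      (signed_perm d.+1 (flip_word od v) && upper (flip_word od v))
        && ((flip_word od v od).1 != od).
    case/andP=> /andP[vd /existsP[j /eqP vj]] ne.
    rewrite flip_word_perm // vd ffunE eqxx ne andbT.
    apply/existsP; exists j; rewrite ffunE; case: (eqVneq j od) => [E|_]; last by rewrite vj.
    by move: ne; rewrite -{1}E vj eqxx.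
  by apply/idP/idP=> /imp //; rewrite flip_wordK.
- by move=> w _; congr (alternates true (sort leq _)); apply/eq_in_map => k;
    rewrite mem_iota /= => kd; congr lab; apply: eq_face => i ik; rewrite ffunE;
    case: eqP => // di; move: ik kd; rewrite di /=; lia.
move=> w _; apply/eqP => /ffunP/(_ od); rewrite ffunE eqxx => /(congr1 snd) /=.
by case: (w od).2.
Qed.

Lemma odd_alt_flag d : d <= n ->
  \big[addb/false]_(w | signed_perm d w) alt_flag true d w = true.
Proof.
elim: d => [_|d IHd dn]; last by rewrite alt_flag_step // IHd // ltnW.
rewrite (big_pred1 [ffun i => (i, true)]) // => w; apply/signed_permP/eqP.
  by case=> _ w_id; apply/ffunP=> i; rewrite ffunE w_id.
by move=> ->; split=> [i j|i _]; rewrite ?ffunE.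
Qed.

(** An alternating maximal chain exists, since there are oddly many.  Its n labels
    have distinct absolute values, because consecutive sorted labels have distinct
    signs and opposite labels are excluded. *)
Theorem octahedral_tucker : n <= m.
Proof.
have /existsP[w] : [exists w, signed_perm n w && alt_flag true n w].
  apply: contraT; rewrite negb_exists => /forallP no.
  have := odd_alt_flag (leqnn n); rewrite big1 // => w wn.
  by apply/negbTE; move: (no w); rewrite wn.
case/andP=> wn; rewrite /alt_flag; set L := sort _ _ => altL.
have inL l : l \in L -> exists2 k, k < n & l = label w k.
  rewrite mem_sort => /mapP[k]; rewrite mem_iota => /andP[_ kn] ->; by exists k.
have : sorted ltn [seq l./2 | l <- L].
  have : sorted leq L := sort_sorted leq_total _.
  have : {in L &, forall x y, y != opp_label x}.
    by move=> x y /inL[j jn ->] /inL[k kn ->]; apply: label_no_opp wn _ _.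
  elim: L true altL {inL} => //= x [|y s] IHs b //= /andP[/eqP ox alts] no /andP[xy ys].
  have -> : path ltn y./2 [seq l./2 | l <- s].
    apply: (IHs (~~ b)) => // u v us vs; by apply: no; rewrite inE ?us ?vs orbT.
  rewrite andbT.
  have /andP[/eqP oy _] := alts.
  have := no x y (mem_head _ _); rewrite !inE eqxx orbT => /(_ isT).
  rewrite /opp_label ox -oy -{1}[y]odd_double_half eqn_add2l eqn_leq leq_double.
  by rewrite leq_double (half_leq xy) andbT -ltnNge.
move=> halves; rewrite -(size_iota 0 n) -(size_map (label w)) -(size_sort leq) -/L.
rewrite -(size_map half) -[leqRHS](size_iota 0 m); apply: uniq_leq_size.
  exact: sorted_uniq ltn_trans ltnn _ halves.
move=> _ /mapP[l /inL[k kn ->] ->]; rewrite mem_iota /= add0n.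
apply: lab_lt; [exact: face_neq0 | exact: face_consistent wn].
Qed.

End Tucker.
(** * The altermatic lower bound for Kneser graphs *)

(** The length of a longest alternating subsequence whose first term differs from
    p.  Comparing p = + with p = - recovers the first nonzero sign, which makes
    the labelling below monotone without any mention of positions. *)
Fixpoint runs (p : sign) (s : seq sign) : nat :=
  if s is x :: s' then
    if (x == None) || (x == p) then runs p s' else (runs x s').+1
  else 0.

Lemma runs_mask p s : exists m : (size s).-tuple bool,
  [/\ size (mask m s) = runs p s, None \notin mask m s
    & path (fun a b => a != b) p (mask m s)].
Proof.
suff [m [sz_m ? ? ?]] : exists m : bitseq, [/\ size m = size s,
    size (mask m s) = runs p s, None \notin mask m s
    & path (fun a b => a != b) p (mask m s)].
  have Em : size m == size s by apply/eqP.
  by exists (Tuple Em).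
elim: s p => [|x s IHs] p /=; first by exists [::].
case: ifPn => [_|/norP[x_nz xp]].
  by have [m [? ? ? ?]] := IHs p; exists (false :: m); split=> //=; congr _.+1.
have [m [sz_m run_m nz_m path_m]] := IHs x; exists (true :: m); split=> //=.
- by rewrite sz_m.
- by rewrite run_m.
- by rewrite inE negb_or eq_sym x_nz.
by rewrite eq_sym xp.
Qed.

Lemma runs_le_alt p s : runs p s <= alt_signs s.
Proof.
have [m [<- nz_m path_m]] := runs_mask p s.
apply: (bigmax_sup m) => //; rewrite /alternating nz_m.
exact: path_sorted path_m.
Qed.

Lemma runs_close b s : runs (Some b) s <= (runs (Some (~~ b)) s).+1.
Proof.
elim: s b => //= [[c|]] s IHs b //=.
by case: c b => [] [] /=; rewrite ?eqxx /=; lia.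
Qed.

(** When an entry is added, the sequence following it loses at most one run by
    [runs_close], and the new entry compensates for it. *)
Lemma runs_mono b (s t : seq sign) :
  all2 (fun x y => (x == None) || (x == y)) s t -> runs (Some b) s <= runs (Some b) t.
Proof.
elim: s t b => [|x s IHs] [|y t] b //= /andP[xy /IHs st].
case: x xy => [c /= /eqP<-|_]; first by case: c b => [] [] /=; rewrite ?ltnS; apply: st.
case: y => [c|] //=; case: ifP => // cb.
have -> : c = ~~ b by case: c b cb => [] [].
by apply: leq_trans (runs_close b s) _; rewrite ltnS; apply: st.
Qed.

Lemma runs_neq s : has (fun x => x != None) s ->
  runs (Some true) s != runs (Some false) s.
Proof.
elim: s => //= [[c|]] s IHs //= _.
by case: c => /=; lia.
Qed.

Lemma runs_opp b s : runs (Some b) (map (omap negb) s) = runs (Some (~~ b)) s.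
Proof.
elim: s b => //= [[c|]] s IHs b //=; rewrite !IHs.
by case: c b => [] [].
Qed.

(** The label built from two quantities competing for the sign: the larger value,
    minus one, is the absolute value of the label and the winner is its sign.
    Both parts of Tucker's labelling have this form, so antipodality and the
    absence of complementary pairs ([score_opp], [score_compl]) are shared. *)
Definition score (g : bool -> nat) :=
  (g false < g true) + ((maxn (g true) (g false)).-1).*2.

Lemma score_half g : (score g)./2 = (maxn (g true) (g false)).-1.
Proof. by rewrite /score half_bit_double. Qed.

Lemma score_opp g h : g true != g false -> (forall b, h b = g (~~ b)) ->
  score h = opp_label (score g).
Proof.
move=> ne hg; rewrite /opp_label score_half /score !hg /= maxnC; congr (_ + _).
by rewrite oddD odd_double addbF oddb -leqNgt ltn_neqAle ne.
Qed.

Lemma score_compl g h : h true != h false -> g true != g false ->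
  (forall b, g b <= h b) -> score h != opp_label (score g).
Proof.
move=> neh neg gh; have := gh true; have := gh false.
rewrite /opp_label score_half /score oddD odd_double addbF oddb.
by case: ltnP; case: ltnP => /=; lia.
Qed.

Lemma opp_label_shift a l : opp_label (a.*2 + l) = a.*2 + opp_label l.
Proof.
by rewrite /opp_label oddD odd_double /= halfD odd_double /= doubleK; lia.
Qed.

Section LowerBound.
Variable H : hypergraph.
Local Notation T := (hvertex H).
Local Notation N := #|{: T}|.
Variables (s : N.-tuple T) (k : nat) (c : {ffun hyperedge H -> 'I_k}).
Hypothesis s_uniq : uniq s.
Hypothesis c_proper : forall A B : hyperedge H, kneser H A B -> c A != c B.

Implicit Type Z : {set 'I_N * bool}.

Definition sign_vector Z : N.-tuple sign :=
  [tuple if (i, true) \in Z then Some true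
         else if (i, false) \in Z then Some false else None | i < N].

Definition signed_class Z b : {set T} := [set tnth s i | i : 'I_N & (i, b) \in Z].

Definition top_color Z b :=
  \max_(B : hyperedge H | val B \subset signed_class Z b) (c B).+1.

(** The vectors with no hyperedge on either side, over which [alt_ordering] is a
    maximum. *)
Definition small Z := edge_free (signed_class Z true) && edge_free (signed_class Z false).

(** Small vectors are labelled by their alternation length and first sign.  For the
    others, a colour class cannot win on both sides, as disjoint hyperedges have
    distinct colours. *)
Definition label_of Z :=
  if small Z then score (fun b => runs (Some (~~ b)) (sign_vector Z))
  else (alt_ordering s).*2 + score (top_color Z).

Lemma in_sign_vector Z i b : consistent Z ->
  (tnth (sign_vector Z) i == Some b) = ((i, b) \in Z).
Proof.
move=> Zc; rewrite tnth_mktuple.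
case: (boolP ((i, true) \in Z)) => it; case: (boolP ((i, false) \in Z)) => i_f.
- by have := Zc _ _ it i_f erefl.
- by case: b; rewrite ?it ?(negbTE i_f).
- by case: b; rewrite ?i_f ?(negbTE it).
- by case: b; rewrite ?(negbTE i_f) ?(negbTE it).
Qed.

Lemma signed_class_sign_class Z b : consistent Z ->
  sign_class s (sign_vector Z) (Some b) = signed_class Z b.
Proof.
move=> Zc; apply/setP=> x; apply/imsetP/imsetP=> [] [i]; rewrite inE => h ->;
  by exists i; rewrite // inE ?in_sign_vector // -in_sign_vector.
Qed.

Lemma mem_opp_set Z i b : ((i, b) \in opp_set Z) = ((i, ~~ b) \in Z).
Proof.
apply/imsetP/idP=> [[[j d] jd [-> ->]]|ib]; first by rewrite negbK.
by exists (i, ~~ b); rewrite //= negbK.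
Qed.

Lemma signed_class_opp Z b : signed_class (opp_set Z) b = signed_class Z (~~ b).
Proof.
apply/setP=> x; apply/imsetP/imsetP=> [] [i]; rewrite inE => h ->;
  by exists i; rewrite // inE; rewrite mem_opp_set in h *.
Qed.

Lemma sign_vector_opp Z : consistent Z ->
  sign_vector (opp_set Z) = map (omap negb) (sign_vector Z) :> seq sign.
Proof.
move=> Zc; rewrite /= -map_comp; apply/eq_map => i /=; rewrite !mem_opp_set /=.
case: (boolP ((i, true) \in Z)) => it; case: (boolP ((i, false) \in Z)) => i_f //=.
by have := Zc _ _ it i_f erefl.
Qed.

Lemma sign_vector_has Z : Z != set0 -> has (fun x => x != None) (sign_vector Z).
Proof.
case/set0Pn=> [[i b] ib]; apply/hasP; exists (tnth (sign_vector Z) i).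
  exact: mem_tnth.
by rewrite tnth_mktuple; case: b ib => ib; rewrite ib //; case: ifP.
Qed.

Lemma sign_vector_sub Z Z' : consistent Z' -> Z \subset Z' ->
  all2 (fun x y => (x == None) || (x == y)) (sign_vector Z) (sign_vector Z').
Proof.
move=> Zc sub; rewrite /sign_vector /= all2E !size_map eqxx /= zip_map.
apply/allP=> _ /mapP[i _ ->] /=.
case: ifP => [it|_]; first by rewrite (subsetP sub _ it).
case: ifP => [i_f|_] //; case: ifP => [it|_]; last by rewrite (subsetP sub _ i_f).
by have := Zc _ _ it (subsetP sub _ i_f) erefl.
Qed.

Lemma signed_class_disjoint Z : consistent Z ->
  [disjoint signed_class Z true & signed_class Z false].
Proof.
move=> Zc; rewrite -setI_eq0; apply/eqP/setP=> x; rewrite !inE; apply/negP.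
case/andP=> /imsetP[i]; rewrite inE => it -> /imsetP[j]; rewrite inE => jf.
by move/(elimT (tuple_uniqP s) s_uniq) => ij; have := Zc _ _ it jf ij.
Qed.

Lemma top_color_gt0 Z : ~~ small Z ->
  (0 < top_color Z true) || (0 < top_color Z false).
Proof.
rewrite /small negb_and.
have gt0 b : ~~ edge_free (signed_class Z b) -> 0 < top_color Z b.
  case/forallPn=> B; rewrite negb_imply negbK => /andP[BH sub].
  by apply: (bigmax_sup (exist _ B BH : hyperedge H)).
by case/orP=> /gt0->; rewrite ?orbT.
Qed.

Lemma top_colorP Z b : 0 < top_color Z b ->
  exists2 B : hyperedge H, val B \subset signed_class Z b & top_color Z b = (c B).+1.
Proof.
move=> gt0.
case: (pickP (fun B : hyperedge H => val B \subset signed_class Z b)) => [B sub|no].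
  have [|B' subB' maxB'] := @eq_bigmax_cond _
    [pred B : hyperedge H | val B \subset signed_class Z b] (fun B => (c B).+1).
    by apply/card_gt0P; exists B.
  by exists B'.
by move: gt0; rewrite /top_color big_pred0.
Qed.

Lemma top_color_neq Z : consistent Z -> ~~ small Z ->
  top_color Z true != top_color Z false.
Proof.
move=> Zc ns; apply/eqP=> E; have := top_color_gt0 ns; rewrite E orbb => gt0f.
have gt0t : 0 < top_color Z true by rewrite E.
have [A subA EA] := top_colorP gt0t; have [B subB EB] := top_colorP gt0f.
have /c_proper/eqP[] : kneser H A B.
  by apply: disjointWl subA (disjointWr subB (signed_class_disjoint Zc)).
by apply: val_inj; have := E; rewrite EA EB => [[]].
Qed.

Lemma signed_class_sub Z Z' b : Z \subset Z' ->
  signed_class Z b \subset signed_class Z' b.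
Proof.
by move=> sub; apply: imsetS; apply/subsetP=> i; rewrite !inE; apply: (subsetP sub).
Qed.

Lemma top_color_mono Z Z' b : Z \subset Z' -> top_color Z b <= top_color Z' b.
Proof.
move=> sub; apply/bigmax_leqP => B subB.
by apply: (bigmax_sup B) => //; exact: subset_trans subB (signed_class_sub b sub).
Qed.

Lemma edge_freeS (A B : {set T}) : A \subset B -> edge_free B -> edge_free A.
Proof.
move=> AB /forall_inP fB; apply/forall_inP=> C /fB; apply: contra => CA.
exact: subset_trans CA AB.
Qed.

Lemma smallS Z Z' : Z \subset Z' -> small Z' -> small Z.
Proof.
by move=> sub /andP[ft ff]; rewrite /small !(edge_freeS (signed_class_sub _ sub)).
Qed.

Lemma score_runs_lt Z : Z != set0 -> consistent Z -> small Z ->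
  (score (fun b => runs (Some (~~ b)) (sign_vector Z)))./2 < alt_ordering s.
Proof.
move=> Z0 Zc sm; have := runs_neq (sign_vector_has Z0).
have le p : runs p (sign_vector Z) <= alt_ordering s.
  apply: leq_trans (runs_le_alt p _) _; rewrite /alt_ordering.
  by apply: (bigmax_sup (sign_vector Z)) => //; rewrite !signed_class_sign_class.
have := le (Some true); have := le (Some false); rewrite score_half /=; lia.
Qed.

(** Labels have absolute values up to alt_ordering s for small vectors and k further
    values for colours, so Tucker's lemma bounds N by their total number. *)
Theorem kneser_lower_bound : N <= alt_ordering s + k.
Proof.
apply: (@octahedral_tucker N _ label_of) => [Z Z0 Zc | Z Z' Z0 Zc' sub | Z Z0 Zc].
- have sE : small (opp_set Z) = small Z by rewrite /small !signed_class_opp andbC.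
  rewrite /label_of sE; case: ifPn => sm.
    apply: score_opp => [|b]; first by rewrite eq_sym; apply: runs_neq (sign_vector_has Z0).
    by rewrite sign_vector_opp // runs_opp.
  rewrite opp_label_shift; congr (_ + _).
  apply: score_opp => [|b]; first exact: top_color_neq.
  by rewrite /top_color signed_class_opp.
- have Zc : consistent Z by move=> x y /(subsetP sub) xZ /(subsetP sub); apply: Zc'.
  have Z0' : Z' != set0 by apply: contraNneq Z0 => E; rewrite -subset0 -E.
  rewrite /label_of; case: (boolP (small Z')) => sm'.
    rewrite (smallS sub sm'); apply: score_compl => [||b].
    + by rewrite eq_sym; apply: runs_neq (sign_vector_has Z0').
    + by rewrite eq_sym; apply: runs_neq (sign_vector_has Z0).
    exact: runs_mono (sign_vector_sub Zc' sub).
  case: ifPn => sm.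
    have := score_runs_lt Z0 Zc sm; set x := score _; set y := score _; rewrite /opp_label.
    by case: (odd x); lia.
  rewrite opp_label_shift eqn_add2l; apply: score_compl => [||b].
  + exact: top_color_neq.
  + exact: top_color_neq.
  exact: top_color_mono.
rewrite /label_of; case: ifPn => sm.
  exact: leq_trans (score_runs_lt Z0 Zc sm) (leq_addr _ _).
rewrite halfD odd_double /= doubleK add0n ltn_add2l score_half.
have le b : top_color Z b <= k by apply/bigmax_leqP => B _.
have := le true; have := le false; have := top_color_neq Zc sm; lia.
Qed.

End LowerBound.
(** * Walks: visits, signs and trail decompositions *)

Definition neq (T : eqType) : rel T := fun x y => x != y.

Lemma alternating_count (b : bool) s : sorted (@neq bool) s ->
  count_mem b s <= (count_mem (~~ b) s).+1.
Proof.
suff H : forall c, path (@neq bool) c s ->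
    count_mem c s <= count_mem (~~ c) s /\ count_mem (~~ c) s <= (count_mem c s).+1.
  case: s H => // c s H cs; have [|] := H (~~ c); first by move: cs => /= ->; case: (c).
  by case: b c {H cs} => [] [] /=; move: (count_mem true s) (count_mem false s); lia.
elim: s => //= d s IHs c /andP[cd /IHs[]].
by case: c d cd => [] [] //= _; move: (count_mem true s) (count_mem false s); lia.
Qed.

Section Walks.
Variable T : finType.
Implicit Types (x y v : T) (p : seq T) (w : T * seq T) (F : seq {set T}).

Definition walk_edges w := pairmap (fun x y => [set x; y]) w.1 w.2.
Definition proper_walk w := path (@neq T) w.1 w.2.
(** The number of ends of the walk w at v; a closed walk from v has two. *)
Definition ends v w := (w.1 == v) + (last w.1 w.2 == v).

Lemma visits_edges v w : proper_walk w ->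
  2 * count_mem v (w.1 :: w.2) = count (fun e : {set T} => v \in e) (walk_edges w) + ends v w.
Proof.
case: w => x p; rewrite /proper_walk /walk_edges /ends /=.
elim: p x => [|y p IHp] x /= ; first by lia.
case/andP=> xy /IHp; rewrite !inE ![v == _]eq_sym.
by move: xy; rewrite /neq; case: (x =P v) => [->|_]; case: (y =P v) => [->|_];
  rewrite ?eqxx //=; lia.
Qed.

(** Each visit of v uses the edge entering and the edge leaving v.  These are
    consecutive, so at most one of them has sign b. *)
Lemma visits_color v w (col : {set T} -> option bool) b :
    proper_walk w -> sorted (@neq bool) (pmap col (walk_edges w)) ->
  count (fun e : {set T} => (v \in e) && (col e == Some b)) (walk_edges w)
    <= count_mem v (w.1 :: w.2).
Proof.
case: w => x p; rewrite /proper_walk /walk_edges /= => px.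
pose first_col e := if e is e :: _ then col e == Some b else false.
pose E x p := pairmap (fun x y => [set x; y]) x p.
suff: sorted (@neq bool) (pmap col (E x p)) ->
    count (fun e : {set T} => (v \in e) && (col e == Some b)) (E x p)
      + (x == v) && ~~ first_col (E x p) <= (x == v) + count_mem v p.
  by move=> H /H; apply: leq_trans; apply: leq_addr.
(* The induction carries a visit in reserve while the first edge at v is not used. *)
elim: p x px => [|y p IHp] x /=; first by lia.
case/andP=> xy /IHp {}IHp alt_p.
have {}IHp : count (fun e : {set T} => (v \in e) && (col e == Some b)) (E y p)
      + (y == v) && ~~ first_col (E y p) <= (y == v) + count_mem v p.
  by apply: IHp; move: alt_p; case: (col [set x; y]) => //= c; apply: path_sorted.
case: (altP (col [set x; y] =P Some b)) alt_p => [-> /= alt_p|_ _]; last first.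
  by rewrite andbF /= andbT add0n addnC leq_add2l; apply: leq_trans IHp; apply: leq_addr.
rewrite andbT andbF addn0 !inE ![v == _]eq_sym.
have nb : first_col (E y p) = false.
  move: alt_p; rewrite /E; case: p {IHp} => //= z p; case: eqP => // -> /=.
  by rewrite /neq eqxx.
move: IHp xy; rewrite nb andbT /neq /E.
case: (x =P v) => [->|_]; case: (y =P v) => [->|_]; rewrite ?eqxx //=;
  by move: (count _ (pairmap _ _ _)) (count_mem v p); lia.
Qed.

Definition rev_walk w := (last w.1 w.2, rev (belast w.1 w.2)).

Lemma last_rev_walk w : last (rev_walk w).1 (rev_walk w).2 = w.1.
Proof.
case: w => x [|y p] //=; rewrite /rev_walk /=.
by rewrite rev_cons last_rcons.
Qed.

Lemma rev_walk_edges w : walk_edges (rev_walk w) = rev (walk_edges w).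
Proof.
case: w => x p; rewrite /walk_edges /=; elim: p x => //= y p IHp x.
rewrite !rev_cons -!cats1 pairmap_cat IHp /=.
by have /= -> := last_rev_walk (y, p); rewrite setUC.
Qed.

Lemma rev_walk_proper w : proper_walk (rev_walk w) = proper_walk w.
Proof.
by rewrite /proper_walk rev_path; apply: eq_path => x y; rewrite /neq eq_sym.
Qed.

Lemma walk_to v w : 0 < ends v w -> exists w', [/\ last w'.1 w'.2 = v,
  perm_eq (walk_edges w') (walk_edges w) & proper_walk w' = proper_walk w].
Proof.
rewrite /ends; case: (w.1 =P v) => [<- _|_].
  exists (rev_walk w); rewrite last_rev_walk rev_walk_proper rev_walk_edges.
  by rewrite perm_rev.
by case: eqP => // <- _; exists w.
Qed.

Lemma walk_from v w : 0 < ends v w -> exists w', [/\ w'.1 = v,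
  perm_eq (walk_edges w') (walk_edges w) & proper_walk w' = proper_walk w].
Proof.
case/walk_to=> w' [E1 E2 E3]; exists (rev_walk w').
by rewrite rev_walk_proper rev_walk_edges perm_rev.
Qed.

Lemma merge_walks v w1 w2 : 0 < ends v w1 -> 0 < ends v w2 ->
    proper_walk w1 -> proper_walk w2 ->
  exists2 w, perm_eq (walk_edges w) (walk_edges w1 ++ walk_edges w2) & proper_walk w.
Proof.
move=> /walk_to[u1 [last1 edges1 <-]] /walk_from[u2 [first2 edges2 <-]] p1 p2.
exists (u1.1, u1.2 ++ u2.2).
  by rewrite /walk_edges pairmap_cat last1 -first2 perm_cat.
by rewrite /proper_walk cat_path last1 -first2; apply/andP.
Qed.

(** Start from single edges.  As long as three ends meet at a vertex, two distinct
    walks end there and can be merged. *)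
Lemma trail_decomposition F :
    {in F, forall e, exists x y, x != y /\ e = [set x; y]} ->
  exists ws, [/\ perm_eq (flatten (map walk_edges ws)) F,
    all proper_walk ws & forall v, \sum_(w <- ws) ends v w <= 2].
Proof.
move=> edgeF.
have [ws0 ws0F ws0p] : exists2 ws, perm_eq (flatten (map walk_edges ws)) F &
    all proper_walk ws.
  elim: F edgeF => [_|e F IHF edgeF]; first by exists [::].
  have [|ws wsF wsp] := IHF; first by move=> f fF; apply: edgeF; rewrite inE fF orbT.
  have [x [y [xy ->]]] := edgeF e (mem_head _ _).
  by exists ((x, [:: y]) :: ws) => /=; rewrite ?perm_cons // /proper_walk /= /neq xy.
have [n] := ubnP (size ws0); elim: n ws0 ws0F ws0p => // n IHn ws wsF wsp wsn.
case: (boolP [forall v, \sum_(w <- ws) ends v w <= 2]) => [/forallP ends2|].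
  by exists ws; split.
case/forallPn=> v; rewrite -ltnNge => ends3.
pose a w := 0 < ends v w.
have [w1 [w2 [ws' [perm_ws a1 a2]]]] : exists w1 w2 ws',
    [/\ perm_eq ws (w1 :: w2 :: ws'), a w1 & a w2].
  have: 1 < size (filter a ws).
    rewrite size_filter ltnNge; apply: contraL ends3 => cnt; rewrite -leqNgt.
    apply: (@leq_trans (2 * count a ws)); last by lia.
    rewrite -sum1_count big_distrr /= [leqRHS]big_mkcond; apply: leq_sum => w _.
    by rewrite /a /ends; case: (_ == v); case: (_ == v).
  have all_a := filter_all a ws.
  case E: (filter a ws) all_a => [|w1 [|w2 ws']] //= /and3P[a1 a2 _] _.
  exists w1, w2, (ws' ++ filter (predC a) ws); split=> //.
  by rewrite -(permPl (permEl (perm_filterC a ws))) E.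
have /and3P[p1 p2 p'] : all proper_walk (w1 :: w2 :: ws') by rewrite -(perm_all _ perm_ws).
have [w w_edges w_p] := merge_walks a1 a2 p1 p2.
apply: (IHn (w :: ws')) => /=.
- apply: perm_trans wsF; rewrite perm_sym.
  apply: perm_trans (perm_flatten (perm_map walk_edges perm_ws)) _ => /=.
  by rewrite catA perm_sym perm_cat2r.
- by rewrite w_p.
by move: wsn; rewrite (perm_size perm_ws) /=; lia.
Qed.

End Walks.
(** * Edge-disjoint flowers in dense graphs *)

Section Flowers.
Variable T : finType.
Implicit Types (x y v u : T) (p : seq T) (Q : {set T}) (g : rel T).

(** Nine neighbours of v, each adjacent to an eighth of the vertices, have two
    members with a common neighbour. *)
Lemma four_cycle g v Q : symmetric g -> irreflexive g ->
    9 <= #|[set w | g v w & w \notin Q]| ->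
    (forall w, g v w -> w \notin Q ->
       #|T| <= 8 * #|[set u | g w u & (u \notin Q) && (u != v)]|) ->
  exists w1 u w2, [/\ uniq [:: v; w1; u; w2],
    [&& g v w1, g w1 u, g u w2 & g w2 v] &
    [&& w1 \notin Q, u \notin Q & w2 \notin Q]].
Proof.
move=> g_sym g_irr; set W := [set w | _ & _] => W9 degW.
pose B u := [set w in W | g w u & (u \notin Q) && (u != v)].
have /existsP[u] : [exists u, 1 < #|B u|].
  apply: contraT; rewrite negb_exists => /forallP B1.
  have sumB : \sum_(w in W) #|[set u | g w u & (u \notin Q) && (u != v)]| <= #|T|.
    under eq_bigr do rewrite -sum1_card big_mkcond /=.
    rewrite exchange_big -sum1_card; apply: leq_sum => u _.
    rewrite -big_mkcondr sum1_card; have := B1 u; rewrite -leqNgt; apply: leq_trans.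
    by apply/eq_leq/eq_card => w; rewrite [LHS]unfold_in !inE.
  have T0 : 0 < #|T| by apply/card_gt0P; exists v.
  have : #|W| * #|T| <= 8 * \sum_(w in W) #|[set u | g w u & (u \notin Q) && (u != v)]|.
    rewrite big_distrr /= -sum_nat_const; apply: leq_sum => w.
    by rewrite inE => /andP[vw wQ]; apply: degW.
  nia.
case/card_gt1P=> w1 [w2 []]; rewrite !inE.
case/and3P=> /andP[vw1 w1Q] w1u /andP[uQ uv] /and3P[/andP[vw2 w2Q] w2u _] w12.
have ne x y : g x y -> x != y by apply: contraTneq => ->; rewrite g_irr.
exists w1, u, w2; split; last by rewrite w1Q uQ w2Q.
- by rewrite /= !inE !negb_or w12 (ne _ _ vw1) (ne _ _ vw2) (ne _ _ w1u) eq_sym uv eq_sym ne.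
by rewrite vw1 w1u g_sym w2u g_sym vw2.
Qed.

Lemma mem_walk_edges x p (e : {set T}) y :
  e \in walk_edges (x, p) -> y \in e -> y \in x :: p.
Proof.
elim: p x => //= z p IHp x; rewrite inE => /orP[/eqP->|/IHp H /H]; rewrite !inE.
  by case/orP=> ->; rewrite ?orbT.
by move=> ->; rewrite orbT.
Qed.

Lemma walk_edges_card w (e : {set T}) : e \in walk_edges w -> #|e| <= 2.
Proof.
case: w => x p; rewrite /walk_edges /=; elim: p x => //= y p IHp x.
by rewrite inE => /orP[/eqP->|/IHp //]; rewrite cards2; case: eqP.
Qed.

(** What matters of t cycles of length 4 through v, disjoint otherwise, joined into a
    closed walk v :: p. *)
Definition flower t v p := [/\ last v p = v, count_mem v p = t, size p = 4 * t
  & forall x, x != v -> count_mem x p <= 1].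

(** Petals are added one by one, avoiding Q and the at most 3 * t inner vertices of
    the previous petals. *)
Lemma flower_exists g v Q t : symmetric g -> irreflexive g ->
    9 + #|Q| + 3 * t <= #|[set w | g v w]| ->
    (forall w, w \notin Q -> #|T| + 8 * (#|Q| + 3 * t + 1) <= 8 * #|[set u | g w u]|) ->
  exists p, [/\ flower t v p, path g v p, uniq (walk_edges (v, p))
    & {in p, forall x, x != v -> x \notin Q}].
Proof.
move=> g_sym g_irr deg_v deg_w.
suff: forall k, k <= t -> exists p, [/\ flower k v p, path g v p,
    uniq (walk_edges (v, p)) & {in p, forall x, x != v -> x \notin Q}] by apply.
elim=> [|k IHk] kt; first by exists [::].
have [p [[last_p visits_p size_p inner_p] path_p uniq_p Q_p]] := IHk (ltnW kt).
pose I := [set x in p | x != v].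
have I3 : #|I| <= 3 * k.
  have -> : 3 * k = size (filter (predC1 v) p).
    have := count_predC (pred1 v) p; rewrite size_filter visits_p size_p.
    have -> : count (predC (pred1 v)) p = count (predC1 v) p by [].
    by move: (count _ p); lia.
  apply: leq_trans (card_size _); apply/eq_leq/eq_card => x.
  by rewrite inE mem_filter andbC.
have cardQI (A : {set T}) : #|A| <= #|[set x in A | x \notin Q :|: I]| + (#|Q| + 3 * k).
  have : #|A| <= #|[set x in A | x \notin Q :|: I] :|: (Q :|: I)|.
    apply: subset_leq_card; apply/subsetP=> x xA; rewrite !inE xA /=.
    by case: (x \in Q) => //=; case: (x \in p) => //=; case: (x != v).
  have := leq_of_leqif (leq_card_setU [set x in A | x \notin Q :|: I] (Q :|: I)).
  have := leq_of_leqif (leq_card_setU Q I); lia.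
have [|w vw|w1 [u [w2 [uniq4 /and4P[vw1 w1u uw2 w2v] /and3P[w1Q uQ w2Q]]]]] :=
    @four_cycle g v (Q :|: I) g_sym g_irr.
- have := cardQI [set w | g v w]; set A := [set x in _ | _]; set B := [set w | _ & _].
  have -> : A = B by apply/setP=> w; rewrite !inE.
  lia.
- rewrite !inE negb_or => /andP[wQ _]; have := deg_w w wQ.
  have := cardQI [set u | g w u]; set A := [set x in _ | _]; set B := [set w | _ & _].
  have : #|A| <= #|B| + 1.
    have : #|A| <= #|B :|: [set v]|.
      apply: subset_leq_card; apply/subsetP=> x; rewrite !inE => /andP[-> ->] /=.
      by case: (x == v).
    by have := leq_of_leqif (leq_card_setU B [set v]); rewrite cards1; lia.
  lia.
have memI x : x \notin Q :|: I -> x != v -> x \notin v :: p.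
  by rewrite !inE negb_or => /andP[_ xp] xv; move: xp; rewrite xv andbT negb_or xv.
move: (uniq4); rewrite /= !inE !negb_or.
case/and4P=> /and3P[vw1' vu vw2'] /andP[w1u' w12] uw2' _.
have w1p := memI _ w1Q (ltac:(by rewrite eq_sym)).
have up := memI _ uQ (ltac:(by rewrite eq_sym)).
have w2p := memI _ w2Q (ltac:(by rewrite eq_sym)).
exists [:: w1, u, w2, v & p]; split.
- split=> //=.
  + by rewrite visits_p ![_ == v]eq_sym eqxx (negbTE vw1') (negbTE vu) (negbTE vw2').
  + by rewrite size_p mulnS.
  move=> x xv; have := inner_p x xv; rewrite ![_ == x]eq_sym (negbTE xv).
  have cnt0 y : y \notin v :: p -> count_mem y p = 0.
    by rewrite inE negb_or => /andP[_ /count_memPn].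
  case: (eqVneq x w1) => [->|_] /=.
    by rewrite (negbTE w1u') (negbTE w12) cnt0.
  case: (eqVneq x u) => [->|_] /=; first by rewrite (negbTE uw2') cnt0.
  by case: (eqVneq x w2) => [->|_] //=; rewrite cnt0.
- by rewrite /= vw1 w1u uw2 w2v.
- rewrite /walk_edges /= -/(walk_edges (v, p)) uniq_p !inE !negb_or.
  have out x y : x \notin v :: p -> [set x; y] \notin walk_edges (v, p).
    by move=> xp; apply: contra xp => /mem_walk_edges; apply; rewrite !inE eqxx.
  have neq2 (e f : {set T}) x : x \in e -> x \notin f -> e != f.
    by move=> xe; apply: contraNneq => <-.
  have n1 : [set v; w1] != [set w1; u].
    by apply: (neq2 _ _ v); rewrite !inE ?eqxx // negb_or vw1' vu.
  have n2 : [set v; w1] != [set u; w2].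
    by apply: (neq2 _ _ v); rewrite !inE ?eqxx // negb_or vw2' vu.
  have n3 : [set v; w1] != [set w2; v].
    by apply: (neq2 _ _ w1); rewrite !inE ?eqxx ?orbT // negb_or w12 eq_sym.
  have n4 : [set w1; u] != [set u; w2].
    by apply: (neq2 _ _ w1); rewrite !inE ?eqxx // negb_or w1u' w12.
  have n5 : [set w1; u] != [set w2; v].
    by apply: (neq2 _ _ w1); rewrite !inE ?eqxx // negb_or w12 eq_sym.
  have n6 : [set u; w2] != [set w2; v].
    by apply: (neq2 _ _ u); rewrite !inE ?eqxx // negb_or uw2' eq_sym.
  by rewrite n1 n2 n3 n4 n5 n6 setUC !out.
move=> x; rewrite !inE => /or4P[/eqP->|/eqP->|/eqP->|].
- by move: w1Q; rewrite !inE negb_or => /andP[].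
- by move: uQ; rewrite !inE negb_or => /andP[].
- by move: w2Q; rewrite !inE negb_or => /andP[].
by case/orP=> [/eqP->|/Q_p //]; rewrite eqxx.
Qed.

Section Packing.
Variables (G : graph T) (t : nat).
Hypothesis t_gt0 : 0 < t.
Hypothesis card_large : 3000 * (t + 1) <= #|T|.
Hypothesis degree_large : forall v, #|T| <= 4 * degree G v.

Definition free_edge (Z : seq {set T}) x y := G x y && ([set x; y] \notin Z).

Lemma free_degree Z x :
  degree G x <= #|[set y | free_edge Z x y]|
                + count (fun e : {set T} => x \in e) Z.
Proof.
have : degree G x <= #|[set y | free_edge Z x y] :|: [set y | G x y & [set x; y] \in Z]|.
  apply: subset_leq_card; apply/subsetP=> y; rewrite !inE /free_edge => -> /=.
  by case: (_ \in _).
move/leq_trans; apply; apply: leq_trans (leq_of_leqif (leq_card_setU _ _)) _.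
rewrite leq_add2l -size_filter; apply: leq_trans (card_size _).
have inj : {in [set y | G x y & [set x; y] \in Z] &, injective (fun y => [set x; y])}.
  move=> y y'; rewrite !inE => /andP[xy _] /andP[xy' _] /setP/(_ y); rewrite !inE eqxx orbT.
  by move/esym/orP=> [/eqP E|/eqP //]; move: xy; rewrite E adj_irrefl.
rewrite -(card_in_imset inj); apply: subset_leq_card; apply/subsetP=> e /imsetP[y].
by rewrite inE => /andP[_ yZ] ->; rewrite mem_filter yZ !inE eqxx.
Qed.

Lemma sum_incidence Z :
  \sum_(u : T) count (fun e : {set T} => u \in e) Z = \sum_(e <- Z) #|e|.
Proof.
under eq_bigr do rewrite -sum1_count big_mkcond.
rewrite exchange_big; apply: eq_bigr => e _.
by rewrite -big_mkcond sum1_card.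
Qed.

(** The flowers are chosen greedily.  A vertex that has become saturated, with 128 * t
    used edges, is kept out of later flowers of other vertices; then no vertex
    ever loses more than 130 * t + 2 of its edges.  As only 4 * t edges are used
    per flower, at most a sixteenth of the vertices are saturated, and the free
    degrees remain large enough for [flower_exists]. *)
Lemma flower_packing (vs : seq T) : uniq vs ->
  exists ws : seq (T * seq T), [/\ map fst ws = vs,
    {in ws, forall w, flower t w.1 w.2 /\ path G w.1 w.2} &
    uniq (flatten (map (@walk_edges T) ws))].
Proof.
move=> vs_uniq.
suff [ws []] : exists ws : seq (T * seq T), [/\ map fst ws = vs,
    {in ws, forall w, flower t w.1 w.2 /\ path G w.1 w.2},
    uniq (flatten (map (@walk_edges T) ws)) &
    forall u, count (fun e : {set T} => u \in e) (flatten (map (@walk_edges T) ws))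
                <= 128 * t + 2 + 2 * t * (u \in vs)]; first by exists ws.
elim: vs vs_uniq => [|v vs IHvs] /=; first by exists [::].
case/andP=> v_vs vs_uniq; have [ws [ws_vs ws_fl ws_uniq ws_deg]] := IHvs vs_uniq.
set Z := flatten _ in ws_uniq ws_deg.
have size_Z : size Z = 4 * t * size vs.
  rewrite /Z -ws_vs size_map; elim: (ws) ws_fl => [|w ws' IHws] fl; first by rewrite muln0.
  have [[_ _ size_w _] _] := fl w (mem_head _ _).
  rewrite /= size_cat size_pairmap size_w IHws ?mulnS // => w' w'ws.
  by apply: fl; rewrite inE w'ws orbT.
have cnt_T : \sum_(u : T) count (fun e : {set T} => u \in e) Z <= 8 * t * #|T|.
  rewrite sum_incidence; apply: (@leq_trans (\sum_(e <- Z) 2)).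
    rewrite big_seq [leqRHS]big_seq; apply: leq_sum => e /flattenP[_ /mapP[w _ ->]].
    by move=> /walk_edges_card.
  rewrite big_const_seq count_predT iter_addn_0 size_Z.
  have : size vs <= #|T|.
    by move/card_uniqP: vs_uniq => <-; apply: max_card.
  nia.
pose Q := [set u | 128 * t <= count (fun e : {set T} => u \in e) Z].
have Q16 : 16 * #|Q| <= #|T|.
  suff : #|Q| * (128 * t) <= 8 * t * #|T| by nia.
  apply: leq_trans cnt_T; rewrite -sum_nat_const big_mkcond; apply: leq_sum => u _.
  by rewrite inE; case: ifP.
have g_sym : symmetric (free_edge Z) by move=> x y; rewrite /free_edge adj_sym setUC.
have g_irr : irreflexive (free_edge Z) by move=> x; rewrite /free_edge adj_irrefl.
have free_large u : #|T| <= 4 * (#|[set y | free_edge Z u y]| + 130 * t + 2).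
  apply: leq_trans (degree_large u) _; rewrite leq_mul2l /=.
  apply: leq_trans (free_degree Z u) _; rewrite -addnA leq_add2l.
  by apply: leq_trans (ws_deg u) _; case: (u \in vs); lia.
have [||p [p_fl p_path p_uniq p_Q]] := @flower_exists _ v Q t g_sym g_irr.
- have := free_large v; move: card_large Q16 t_gt0; lia.
- move=> w _; have := free_large w; move: card_large Q16 t_gt0; lia.
have p_G : path G v p by apply: sub_path p_path => x y /andP[].
have p_proper : proper_walk (v, p).
  by apply: sub_path p_G => x y; apply: contraTneq => ->; rewrite adj_irrefl.
have p_free : {in walk_edges (v, p), forall e, e \notin Z}.
  move: p_path; rewrite /walk_edges /=.
  elim: (p) (v) => //= y p' IHp' x /andP[/andP[_ xyZ] /IHp' H] e.
  by rewrite inE => /orP[/eqP-> // | /H].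
exists ((v, p) :: ws); split=> /=.
- by rewrite ws_vs.
- by move=> w; rewrite inE => /orP[/eqP->|/ws_fl].
- rewrite cat_uniq p_uniq ws_uniq andbT /=; apply/hasPn=> e eZ.
  by apply/negP=> /p_free; rewrite eZ.
move=> u; rewrite count_cat -/Z.
have [last_p visits_p _ inner_p] := p_fl.
have := visits_edges u p_proper; rewrite /ends /= last_p ![_ == u]eq_sym inE.
case: (eqVneq u v) => [->|uv] /=.
  have := ws_deg v; rewrite (negbTE v_vs) visits_p.
  by set a := count _ Z; set b := count _ _; lia.
have := ws_deg u; have := inner_p u uv.
case: (boolP (u \in p)) => up; last first.
  rewrite (count_memPn up); set a := count _ Z; set b := count _ _.
  by case: (u \in vs); lia.
have := p_Q u up uv; rewrite inE -ltnNge.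
set a := count _ Z; set b := count _ (walk_edges _); set c := count_mem u p.
by case: (u \in vs); lia.
Qed.

End Packing.

End Flowers.
(** * An ordering of the edges with few alternations *)

Section Ordering.
Variable T : finType.
Implicit Types (v : T) (col : {set T} -> option bool) (ws : seq (T * seq T)).

Lemma count_mem_pmap col b s :
  count_mem b (pmap col s) = count (fun e => col e == Some b) s.
Proof.
by elim: s => //= e s IHs; case: (col e) => [c|] /=; rewrite IHs.
Qed.

Lemma count_walks (a : pred {set T}) ws :
  count a (flatten (map (@walk_edges T) ws)) = \sum_(w <- ws) count a (walk_edges w).
Proof. by elim: ws => [|w ws IHws]; rewrite ?big_nil // big_cons /= count_cat IHws. Qed.

Lemma sorted_walk col ws w : w \in ws ->
    sorted (@neq bool) (pmap col (flatten (map (@walk_edges T) ws))) ->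
  sorted (@neq bool) (pmap col (walk_edges w)).
Proof.
case/path.splitPr=> ws1 ws2; rewrite map_cat flatten_cat /= !pmap_cat.
by case/cat_sorted2=> _ /cat_sorted2[].
Qed.

Lemma count_touching (a : pred {set T}) (S : {set T}) s :
  count a s <= count (fun e => a e && [disjoint e & S]) s
               + \sum_(x in S) count (fun e : {set T} => x \in e) s.
Proof.
elim: s => //= e s IHs; rewrite big_split /=.
have : a e <= a e && [disjoint e & S] + \sum_(x in S) (x \in e).
  case: (a e) => //=; case: (boolP [disjoint e & S]) => //.
  rewrite -setI_eq0 => /set0Pn[x]; rewrite inE => /andP[xe xS].
  by rewrite (bigD1 x) //= xe.
by move: IHs; lia.
Qed.

(** Along the ordering s, an alternating colouring gives v at most half of its
    edges in colour b, with a margin R.  The exceptions are paid for by a set S,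
    meant to touch almost all edges of the other colour, and by the edges of the
    other colour that escape S. *)
Definition alternating_bound (G : graph T) (R : nat) (s : seq {set T}) :=
  forall col v b (S : {set T}), v \notin S -> sorted (@neq bool) (pmap col s) ->
    2 * count (fun e : {set T} => (v \in e) && (col e == Some b)) s + R
      <= count (fun e : {set T} => v \in e) s + 4 * #|S|
         + 2 * count (fun e => (col e == Some (~~ b)) && [disjoint e & S]) s.

(** List the edges of the flowers, then those of a trail decomposition of the
    remaining edges.  At v there are at most four ends of walks, two from its own
    flower and two from the trails.  In the flower of v, alternation bounds the
    edges of colour b by those of the other colour, each of which escapes S or
    is one of the at most two edges at a vertex of S. *)
Lemma alternating_ordering (G : graph T) R :
    3000 * (R + 3) <= #|T| -> (forall v, #|T| <= 4 * degree G v) ->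
  exists s, [/\ uniq s, s =i edge_set G & alternating_bound G R s].
Proof.
(* A flower with t petals contributes 2 * t to the degree of v, and 4 is lost to the
   ends of walks and to rounding. *)
move=> cardT degG; pose t := R + 2.
have [||ws1 [ws1_fst ws1_fl ws1_uniq]] :=
    @flower_packing T G t _ _ degG (enum T) (enum_uniq T).
- by rewrite /t addn2.
- by rewrite /t -addnA.
set Z := flatten _ in ws1_uniq.
have ws1_proper : all (@proper_walk T) ws1.
  apply/allP=> w /ws1_fl[_]; apply: sub_path => x y.
  by apply: contraTneq => ->; rewrite adj_irrefl.
have Z_G : {subset Z <= edge_set G}.
  move=> e /flattenP[_ /mapP[w /ws1_fl[_ path_w] ->]].
  case: w path_w => x p; rewrite /walk_edges /=; elim: p x => //= y p IHp x /andP[xy /IHp H].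
  by rewrite inE => /orP[/eqP->|/H //]; apply/imsetP; exists (x, y); rewrite ?inE.
have [|ws2 [ws2_perm ws2_proper ws2_ends]] :=
    @trail_decomposition T (filter [predC Z] (enum (edge_set G))).
  move=> e; rewrite mem_filter mem_enum => /andP[_ /imsetP[[x y] /=]].
  rewrite inE /= => xy ->; exists x, y; split=> //.
  by apply: contraTneq xy => ->; rewrite adj_irrefl.
pose ws := ws1 ++ ws2; exists (flatten (map (@walk_edges T) ws)).
have sE : flatten (map (@walk_edges T) ws) = Z ++ flatten (map (@walk_edges T) ws2).
  by rewrite map_cat flatten_cat.
split.
- rewrite sE cat_uniq ws1_uniq (perm_uniq ws2_perm) filter_uniq ?enum_uniq //= andbT.
  by apply/hasPn=> e; rewrite (perm_mem ws2_perm) mem_filter => /andP[].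
- move=> e; rewrite sE mem_cat (perm_mem ws2_perm) mem_filter mem_enum /=.
  by case: (boolP (e \in Z)) => [/Z_G->|].
move=> col v b S vS alt_s.
have proper_ws w : w \in ws -> proper_walk w.
  have /allP : all (@proper_walk T) ws by rewrite all_cat ws1_proper.
  by apply.
have [w w_ws1 w_v] : exists2 w, w \in ws1 & w.1 = v.
  have : v \in map fst ws1 by rewrite ws1_fst mem_enum.
  by case/mapP=> w ? ->; exists w.
have w_ws : w \in ws by rewrite mem_cat w_ws1.
have sum_ends : \sum_(u <- ws) ends v u <= 4.
  rewrite big_cat /= -[4]/(2 + 2); apply: leq_add => //.
  have -> : \sum_(u <- ws1) ends v u = 2 * count_mem v (map fst ws1).
    rewrite count_map -sum1_count big_distrr /= [RHS]big_mkcond.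
    apply: eq_big_seq => u /ws1_fl[[]].
    by rewrite /ends => -> _ _ _ _ /=; case: eqP.
  by rewrite ws1_fst count_uniq_mem ?enum_uniq // mem_enum.
have [[w_last w_visits _ w_inner] _] := ws1_fl w w_ws1.
rewrite w_v in w_last w_visits w_inner.
have w_deg : count (fun e : {set T} => v \in e) (walk_edges w) = 2 * t.
  have := visits_edges v (proper_ws w w_ws).
  rewrite /ends w_v w_last eqxx /= eqxx w_visits; set a := count _ _; lia.
have w_ends : ends v w = 2 by rewrite /ends w_v w_last eqxx.
set stray := count (fun e => (col e == _) && _) _.
have w_color : count (fun e : {set T} => (v \in e) && (col e == Some b)) (walk_edges w)
    <= stray + 2 * #|S| + 1.
  apply: (@leq_trans (count (fun e => col e == Some b) (walk_edges w))).
    by apply: sub_count => e /andP[].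
  rewrite -count_mem_pmap addn1.
  apply: leq_trans (alternating_count b (sorted_walk w_ws alt_s)) _.
  rewrite ltnS count_mem_pmap.
  apply: leq_trans (count_touching _ S _) _; apply: leq_add.
    rewrite /stray count_walks (perm_big _ (perm_to_rem w_ws)) big_cons; exact: leq_addr.
  rewrite mulnC -sum_nat_const; apply: leq_sum => x xS.
  have xv : x != v by apply: contraNneq vS => <-.
  have := visits_edges x (proper_ws w w_ws); have := w_inner x.
  rewrite /ends w_v w_last [v == x]eq_sym (negbTE xv) /= => /(_ isT).
  rewrite [v == x]eq_sym (negbTE xv); set a := count _ _; set c := count _ _; lia.
rewrite !count_walks !(perm_big _ (perm_to_rem w_ws)) !big_cons /=.
move: sum_ends; rewrite (perm_big _ (perm_to_rem w_ws)) big_cons w_ends w_deg.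
have : 2 * \sum_(j <- rem w ws)
         count (fun e : {set T} => (v \in e) && (col e == Some b)) (walk_edges j)
    <= \sum_(j <- rem w ws) count (fun e : {set T} => v \in e) (walk_edges j)
       + \sum_(j <- rem w ws) ends v j.
  rewrite big_distrr -big_split /= big_seq [leqRHS]big_seq; apply: leq_sum => u /mem_rem u_ws.
  rewrite -visits_edges ?proper_ws // leq_mul2l /=.
  exact: visits_color (proper_ws _ u_ws) (sorted_walk u_ws alt_s).
move: w_color; rewrite /stray count_walks (perm_big _ (perm_to_rem w_ws)) big_cons /=.
set A := \sum_(j <- _) _; set B := \sum_(j <- _) _.
set C := \sum_(j <- _) _; set D := \sum_(j <- _) _.
set E1 := count _ _; set E2 := count _ _; rewrite /t; lia.
Qed.

End Ordering.
(** * Edge sets without r disjoint edges *)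

Lemma subset_of_card (T : finType) (A : {set T}) k : k <= #|A| ->
  exists2 B : {set T}, B \subset A & #|B| = k.
Proof.
move=> kA; exists [set x in take k (enum A)].
  by apply/subsetP=> x; rewrite inE => /mem_take; rewrite mem_enum.
rewrite cardsE (card_uniqP _) ?take_uniq ?enum_uniq // size_takel //.
by rewrite -cardE.
Qed.

Section MatchingFree.
Variables (T : finType) (G : graph T) (r : nat).
Implicit Types (P M F : {set {set T}}) (e : {set T}) (S C A X : {set T}) (v x : T).
Local Notation E := (edge_set G).

Definition star F v := [set e in F | v \in e].
Definition avoiding F S := [set e in F | [disjoint e & S]].
Definition touching S := [set e in E | ~~ [disjoint e & S]].

Lemma edge_set2 e v x : e \in E -> v \in e -> x \in e -> v != x -> e = [set v; x].
Proof.
case/imsetP=> [[a b] _ ->] /=; rewrite !inE.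
case/orP=> /eqP-> /orP[/eqP->|/eqP->]; rewrite ?eqxx //; by rewrite setUC.
Qed.

Lemma card_edge e : e \in E -> #|e| = 2.
Proof.
case/imsetP=> [[a b]]; rewrite inE /= => ab ->.
by rewrite cards2; case: eqP ab => // ->; rewrite adj_irrefl.
Qed.

(** An edge at v touching X is determined by its end in X. *)
Lemma star_touching F v X : F \subset E -> v \notin X ->
  #|[set e in star F v | ~~ [disjoint e & X]]| <= #|X|.
Proof.
move=> FE vX; apply: leq_trans (leq_imset_card (fun x => [set v; x]) X).
apply: subset_leq_card; apply/subsetP=> e; rewrite !inE => /andP[/andP[eF ve]].
rewrite -setI_eq0 => /set0Pn[x]; rewrite inE => /andP[xe xX].
apply/imsetP; exists x => //; apply: edge_set2 => //; first exact: (subsetP FE).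
by apply: contraNneq vX => ->.
Qed.

Lemma card_cover_edges M : M \subset E -> #|cover M| <= 2 * #|M|.
Proof.
move=> ME; apply: leq_trans (leq_card_cover M) _.
by rewrite mulnC -sum_nat_const; apply: leq_sum => e /(subsetP ME)/card_edge->.
Qed.

(** A vertex of S has fewer than 2 * r vertices to avoid, those of M and the others
    of S, so one of its edges in P can be added to M. *)
Lemma matching_extend P S M : P \subset E ->
    (forall v, v \in S -> 2 * r <= #|star P v|) ->
    M \subset P -> trivIset M -> [disjoint cover M & S] -> #|M| + #|S| <= r ->
  exists M', [/\ M' \subset P, trivIset M' & #|M'| = #|M| + #|S|].
Proof.
move=> PE; have [n] := ubnP #|S|; elim: n S M => // n IHn S M Sn degS MP trivM covM MSr.
have [->|[s sS]] := set_0Vmem S; first by exists M; rewrite cards0 addn0.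
have cardS := cardsD1 s S; rewrite sS in cardS.
pose X := cover M :|: (S :\ s).
have sM : s \notin cover M by rewrite (disjointFl covM).
have sX : s \notin X by rewrite !inE eqxx /= orbF.
have X2r : #|X| < 2 * r.
  have := leq_of_leqif (leq_card_setU (cover M) (S :\ s)).
  have := card_cover_edges (subset_trans MP PE); rewrite -/X; lia.
have [e eP] : exists e, (e \in star P s) && [disjoint e & X].
  apply/existsP; apply: contraT; rewrite negb_exists => /forallP no.
  have := star_touching PE sX; rewrite leqNgt; case/negP; apply: leq_trans X2r _.
  apply: leq_trans (degS s sS) _; apply: subset_leq_card; apply/subsetP=> e es.
  by rewrite inE es; have := no e; rewrite es.
case/andP: eP; rewrite inE => /andP[eP se] eX.
have eM f : f \in M -> [disjoint e & f].
  move=> fM; apply: disjointWr eX; apply: subset_trans (subsetUl _ _).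
  exact: (bigcup_max f).
have M0 : set0 \notin M.
  by apply/negP=> /(subsetP MP)/(subsetP PE)/card_edge; rewrite cards0.
have [triv1 e_notin] := trivIsetU1 eM trivM M0.
have [|||||M' [M'P trivM' cardM']] := IHn (S :\ s) (e |: M) _ _ _ triv1.
- by move: Sn; rewrite cardS; clear; lia.
- by move=> v; rewrite inE => /andP[_ /degS].
- by apply/subsetP=> f; rewrite !inE => /orP[/eqP->|/(subsetP MP)].
- have -> : cover (e |: M) = e :|: cover M by rewrite /cover bigcup_setU big_set1.
  rewrite -setI_eq0 setIUl setU_eq0 !setI_eq0; apply/andP; split.
    by apply: disjointWr eX; apply: subsetUr.
  by apply: disjointWr covM; apply: subsetDl.
- by rewrite cardsU1 e_notin; move: MSr; rewrite cardS; clear; lia.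
exists M'; split=> //; rewrite cardM' cardsU1 e_notin cardS; clear; lia.
Qed.

(** The threshold 2 * r exceeds the number of vertices of fewer than r edges, so that
    a hub extends any matching that is still too small. *)
Definition hubs P := [set v | 2 * r <= #|star P v|].

(** Let M be a maximal matching among the edges avoiding the hubs.  Extending it
    through the hubs shows that #|M| + #|hubs P| < r.  Every edge avoiding the hubs
    meets one of the 2 * #|M| vertices of M, none of which is a hub. *)
Lemma matching_free_structure P : P \subset E -> matchings r P = set0 ->
  #|hubs P| < r /\ #|avoiding P (hubs P)| <= 4 * r * (r.-1 - #|hubs P|).
Proof.
move=> PE noM; set S := hubs P.
have small M : M \subset P -> trivIset M -> #|M| != r.
  move=> MP trivM; apply/eqP=> cM; have : M \in matchings r P by rewrite inE MP trivM cM /=.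
  by rewrite noM inE.
pose ok M := (M \subset avoiding P S) && trivIset M.
have ok0 : ok set0 by rewrite /ok sub0set /trivIset /cover !big_set0 cards0.
case: (arg_maxnP (fun M => #|M|) ok0) => M /andP[M_av trivM] maxM.
have MP : M \subset P by apply: subset_trans M_av _; apply/subsetP=> e; rewrite inE => /andP[].
have covM : [disjoint cover M & S].
  rewrite disjoint_sym; apply/bigcup_disjointP => e /(subsetP M_av).
  by rewrite inE disjoint_sym => /andP[].
have kSr : #|M| + #|S| < r.
  rewrite ltnNge; apply/negP=> rMS.
  have Mr : #|M| < r.
    rewrite ltnNge; apply/negP=> /subset_of_card[M' M'M cM'].
    have := small M' (subset_trans M'M MP) (trivIsetS M'M trivM).
    by rewrite cM' eqxx.
  have [|S' S'S cS'] := @subset_of_card _ S (r - #|M|); first lia.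
  have [|||M' [M'P trivM' cM']] := @matching_extend P S' M PE _ MP trivM _ _.
  - by move=> v /(subsetP S'S); rewrite inE.
  - exact: disjointWr S'S covM.
  - lia.
  by have := small M' M'P trivM'; rewrite cM' cS' subnKC ?eqxx // ltnW.
split; first by apply: leq_ltn_trans kSr; apply: leq_addl.
apply: (@leq_trans (\sum_(x in cover M) #|star P x|)); last first.
  apply: (@leq_trans (#|cover M| * (2 * r))).
    rewrite -sum_nat_const; apply: leq_sum => x /(disjointFr covM).
    by rewrite inE => /negbT; rewrite -ltnNge => /ltnW.
  have := card_cover_edges (subset_trans MP PE); nia.
have : #|\bigcup_(x in cover M) star P x| <= \sum_(x in cover M) #|star P x|.
  elim/big_rec2: _ => [|x a A _ le]; first by rewrite cards0.
  by apply: leq_trans (leq_of_leqif (leq_card_setU _ _)) _; rewrite leq_add2l.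
apply: leq_trans; apply: subset_leq_card; apply/subsetP=> e e_av.
have eE : e \in E by move: e_av; rewrite inE => /andP[/(subsetP PE)].
have eP : e \in P by move: e_av; rewrite inE => /andP[].
apply: contraT => e_out.
have e_cov : [disjoint e & cover M].
  rewrite -setI_eq0; apply: contraNT e_out => /set0Pn[x]; rewrite inE => /andP[xe xM].
  by apply/bigcupP; exists x => //; rewrite inE eP.
have eM f : f \in M -> [disjoint e & f].
  by move=> fM; apply: disjointWr e_cov; apply: (bigcup_max f).
have M0 : set0 \notin M.
  by apply/negP=> /(subsetP MP)/(subsetP PE)/card_edge; rewrite cards0.
have [triv1 e_notin] := trivIsetU1 eM trivM M0.
have : #|e |: M| <= #|M|.
  apply: maxM; rewrite /ok triv1 andbT; apply/subsetP=> f.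
  by rewrite in_setU1 => /orP[/eqP->|/(subsetP M_av)].
by rewrite cardsU1 e_notin add1n ltnn.
Qed.

(** Disjoint edges touching S contain distinct elements of S. *)
Lemma touching_turan S : #|S| < r -> #|touching S| <= turan_matching G r.
Proof.
move=> Sr; apply: (bigmax_sup (touching S)) => //; apply/andP; split.
  by apply/subsetP=> e; rewrite inE => /andP[].
apply: contraT => /set0Pn[M]; rewrite inE => /and3P[MS trivM /eqP cM].
have [f_inj f_S] : {in M &, injective (fun e => [pick x in e :&: S])} /\
    (fun e => [pick x in e :&: S]) @: M \subset Some @: S.
  have fP e : e \in M -> exists2 x, [pick x in e :&: S] = Some x & (x \in e) && (x \in S).
    move=> /(subsetP MS); rewrite inE => /andP[_]; rewrite -setI_eq0 => /set0Pn[x xeS].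
    by case: pickP => [y|/(_ x)]; [rewrite inE; exists y | rewrite xeS].
  split.
    move=> e f eM fM; have [x -> /andP[xe _]] := fP e eM; have [y -> /andP[yf _]] := fP f fM.
    move=> [exy]; apply/eqP; apply: contraT => ef.
    have := trivIsetP trivM e f eM fM ef => /disjointFr/(_ xe).
    by rewrite exy yf.
  apply/subsetP=> o /imsetP[e /fP[x -> /andP[_ xS]] ->]; exact: imset_f.
have := subset_leq_card f_S; rewrite (card_in_imset f_inj) cM.
move=> /leq_trans/(_ (leq_imset_card _ _)).
by rewrite leqNgt Sr.
Qed.

Lemma touching_add S v : v \notin S ->
  #|touching S| + #|star E v| <= #|touching (v |: S)| + #|S|.
Proof.
move=> vS; have := star_touching (subxx E) vS; set A := [set e in star E v | _] => AS.
apply: (@leq_trans (#|touching (v |: S)| + #|A|)); last by rewrite leq_add2l.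
rewrite -[leqLHS]cardsUI; apply: leq_add; apply: subset_leq_card; apply/subsetP=> e; last first.
  by rewrite !inE => /andP[/andP[-> ->] /andP[_ ->]].
rewrite !inE => /orP[/andP[-> eS]|/andP[-> ve]] /=.
  by apply: contra eS; apply: disjointWr; apply: subsetUr.
by apply/negP=> /disjointFr/(_ ve); rewrite !inE eqxx.
Qed.

Lemma touching_union C A : [disjoint C & A] -> #|C| + #|A| <= r ->
  #|touching C| + \sum_(v in A) #|star E v| <= #|touching (C :|: A)| + #|A| * r.
Proof.
have [n] := ubnP #|A|; elim: n A => // n IHn A An CA CAr.
have [->|[v vA]] := set_0Vmem A; first by rewrite big_set0 setU0 cards0.
have cardA := cardsD1 v A; rewrite vA in cardA.
have CA' : [disjoint C & A :\ v] by apply: disjointWr CA; apply: subsetDl.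
have A'n : #|A :\ v| < n by move: An; rewrite cardA; clear; lia.
have CA'r : #|C| + #|A :\ v| <= r by move: CAr; rewrite cardA; clear; lia.
have := IHn _ A'n CA' CA'r; rewrite (big_setD1 v vA) /=.
have v_out : v \notin C :|: (A :\ v).
  by rewrite !inE eqxx /= orbF (disjointFl CA).
have := touching_add v_out; have -> : v |: (C :|: A :\ v) = C :|: A.
  by rewrite setUCA setD1K.
have := leq_of_leqif (leq_card_setU C (A :\ v)).
rewrite cardA add1n mulSn; move: CA'r; clear.
move: (\sum_(_ in _) _) #|star _ _| #|touching _| (_ * r).
by move: #|C| #|A :\ v| #|C :|: A :\ v| #|touching _| #|touching (C :|: A)|; lia.
Qed.

(** The form taken by [alternating_bound] when P and M are the colour classes. *)
Definition pairing_bound R P M :=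
  forall v S, v \notin S ->
    2 * #|star P v| + R <= #|star E v| + 4 * #|S| + 2 * #|avoiding M S|.

Hypothesis degree_large : forall v, 9 * r <= #|star E v|.
Hypothesis card_large : r <= #|T|.

(** Enlarge the hubs of P outside C = hubs P :&: hubs M to a set A :|: B with
    #|C| + #|A :|: B| = r.-1.  Adding A :|: B to C gains all edges at its vertices
    up to r for each of them.  Twice the degree in P of a vertex of A is smaller
    than its degree in G by r at least, by the pairing bound; a vertex of B has
    degree large enough to pay for the 4 * r edges of P allowed by a missing
    hub. *)
Lemma avoiding_bound P M : P \subset E -> M \subset E ->
    matchings r P = set0 -> matchings r M = set0 ->
    pairing_bound (2 * (4 * r * r) + 5 * r) P M ->
  #|touching (hubs P :&: hubs M)| + 2 * #|avoiding P (hubs P :&: hubs M)|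
    <= turan_matching G r.
Proof.
move=> PE ME noP noM bound; set C := hubs P :&: hubs M.
have [hubP avP] := matching_free_structure PE noP.
have [hubM avM] := matching_free_structure ME noM.
pose A := hubs P :\: hubs M.
have cardA : #|A| + #|C| = #|hubs P| by rewrite addnC cardsID.
(* B fills the places of the missing hubs of P. *)
have [|B BC cardB] := @subset_of_card _ (~: hubs P) (r.-1 - #|hubs P|).
  by have := cardsC (hubs P); move: card_large; clear; move: #|T| #|hubs P| #|~: _|; lia.
have hubB : [disjoint hubs P & B] by rewrite disjoint_sym disjoints_subset.
have AB : [disjoint A & B] by apply: disjointWl hubB; apply: subsetDl.
have CAB : [disjoint C & A :|: B].
  rewrite -setI_eq0 setIUr setU_eq0 !setI_eq0; apply/andP; split.
    rewrite -setI_eq0; apply/eqP/setP=> x; rewrite /C !(in_setI, in_setD, in_set0).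
    by case: (x \in hubs M); rewrite ?andbF.
  by apply: disjointWl hubB; apply: subsetIl.
have cardAB : #|A :|: B| = #|A| + #|B|.
  by apply/eqP; have := leq_card_setU A B => /leqifP; rewrite AB.
have [CABr1 CABr] : #|C| + #|A :|: B| < r /\ #|C| + #|A :|: B| <= r.
  by rewrite cardAB cardB; move: cardA hubP; clear; lia.
have tur : #|touching (C :|: (A :|: B))| <= turan_matching G r.
  apply: touching_turan; apply: leq_ltn_trans CABr1.
  exact: leq_of_leqif (leq_card_setU _ _).
have := touching_union CAB CABr.
have avC : #|avoiding P C| <= \sum_(v in A) #|star P v| + 4 * r * #|B|.
  apply: (@leq_trans (#|\bigcup_(v in A) star P v| + #|avoiding P (hubs P)|)).
    apply: leq_trans (leq_of_leqif (leq_card_setU _ _)); apply: subset_leq_card.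
    apply/subsetP=> e; rewrite !inE => /andP[eP eC]; rewrite eP /= orbC.
    case: (boolP [disjoint e & hubs P]) => //= ; rewrite -setI_eq0 => /set0Pn[x].
    rewrite inE => /andP[xe xP]; apply/bigcupP; exists x; last by rewrite inE eP.
    by rewrite inE xP andbT; apply/negP=> xM; have := disjointFr eC xe; rewrite inE xP xM.
  apply: leq_add; last by rewrite cardB.
  elim/big_rec2: _ => [|x a D _ le]; first by rewrite cards0.
  by apply: leq_trans (leq_of_leqif (leq_card_setU _ _)) _; rewrite leq_add2l.
have sumA : 2 * \sum_(v in A) #|star P v| + #|A| * r <= \sum_(v in A) #|star E v|.
  rewrite big_distrr -sum_nat_const -big_split; apply: leq_sum => v /= vA.
  have vM : v \notin hubs M by move: vA; rewrite inE => /andP[].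
  have := bound v _ vM; have : 4 * r * (r.-1 - #|hubs M|) <= 4 * r * r.
    by rewrite leq_mul2l; apply/orP; right; clear; lia.
  move: hubM avM; clear.
  move: (4 * r * (r.-1 - _)) (4 * r * r).
  by move: #|hubs M| #|avoiding _ _| #|star E v| #|star P v|; lia.
have sumB : #|B| * (9 * r) <= \sum_(v in B) #|star E v|.
  by rewrite -sum_nat_const; apply: leq_sum.
have -> : \sum_(v in A :|: B) #|star E v|
        = \sum_(v in A) #|star E v| + \sum_(v in B) #|star E v|.
  by rewrite -bigU //; apply: eq_bigl => v; rewrite in_setU.
rewrite cardAB; move: tur avC sumA sumB; clear.
set a := \sum_(v in A) _; set b := \sum_(v in A) _; set c := \sum_(v in B) _.
nia.
Qed.

(** The mean of the two bounds of [avoiding_bound], as an edge of P or M touches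
    C = hubs P :&: hubs M or avoids it. *)
Lemma alternating_turan P M : P \subset E -> M \subset E -> [disjoint P & M] ->
    matchings r P = set0 -> matchings r M = set0 ->
    pairing_bound (2 * (4 * r * r) + 5 * r) P M ->
    pairing_bound (2 * (4 * r * r) + 5 * r) M P ->
  #|P| + #|M| <= turan_matching G r.
Proof.
move=> PE ME PM noP noM bP bM.
have := avoiding_bound PE ME noP noM bP; have := avoiding_bound ME PE noM noP bM.
rewrite /= setIC; set C := hubs P :&: _.
suff : #|P| + #|M| <= #|touching C| + (#|avoiding P C| + #|avoiding M C|).
  by clear; move: #|touching C| #|avoiding P C| #|avoiding M C| #|P| #|M|; lia.
have <- : #|P :|: M| = #|P| + #|M|.
  by apply/eqP; have := leq_card_setU P M => /leqifP; rewrite PM.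
apply: leq_trans (_ : #|touching C :|: (avoiding P C :|: avoiding M C)| <= _).
  apply: subset_leq_card; apply/subsetP=> e; rewrite !inE.
  by case: [disjoint e & C] => /orP[] eX;
    rewrite ?eX ?orbT ?(subsetP PE _ eX) ?(subsetP ME _ eX).
apply: leq_trans (leq_of_leqif (leq_card_setU _ _)) _; rewrite leq_add2l.
exact: leq_of_leqif (leq_card_setU _ _).
Qed.

End MatchingFree.
(** * Chromatic and altermatic numbers of matching graphs *)

Lemma geq_bigmin (I : finType) (P : pred I) (F : I -> nat) c i : P i ->
  \big[minn/c]_(j | P j) F j <= F i.
Proof.
move=> Pi; have : i \in index_enum I by rewrite mem_index_enum.
elim: (index_enum I) => //= j s IHs; rewrite inE big_cons => /orP[/eqP<-|/IHs le].
  by rewrite Pi geq_minl.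
by case: ifP => // _; apply: leq_trans le; apply: geq_minr.
Qed.

Lemma leq_bigmin (I : finType) (P : pred I) (F : I -> nat) c k : k <= c ->
  (forall i, P i -> k <= F i) -> k <= \big[minn/c]_(j | P j) F j.
Proof.
move=> kc kF; elim/big_rec: _ => // i x Pi kx.
by rewrite leq_min kF.
Qed.

Section Coloring.
Variables (T : finType) (F : graph T).

Lemma colorableP k :
  reflect (exists c : T -> 'I_k, forall x y, F x y -> c x != c y) (colorable F k).
Proof.
apply: (iffP existsP) => [[c /forallP cF]|[c cF]].
  by exists c => x y xy; have /forallP/(_ y)/implyP := cF x; apply.
exists (finfun c); apply/forallP=> x; apply/forallP=> y; apply/implyP=> /cF.
by rewrite !ffunE.
Qed.

Lemma colorable_chromatic : colorable F (chromatic_number F).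
Proof. by rewrite /chromatic_number; case: ex_minnP. Qed.

Lemma chromatic_leq k : colorable F k -> chromatic_number F <= k.
Proof. by rewrite /chromatic_number; case: ex_minnP => n _; apply. Qed.

End Coloring.

Lemma homomorphic_colorable (T1 T2 : finType) (F1 : graph T1) (F2 : graph T2) k :
  homomorphic F1 F2 -> colorable F2 k -> colorable F1 k.
Proof.
case=> f fF /colorableP[c cF]; apply/colorableP; exists (c \o f) => x y /fF; exact: cF.
Qed.

Lemma altermatic_bound_leq (H : hypergraph) k :
  colorable (kneser H) k -> altermatic_bound H <= k.
Proof.
case/existsP=> c /forallP c_proper; rewrite /altermatic_bound leq_subLR addnC -leq_subLR.
apply: leq_bigmin; first exact: leq_subr.
move=> s s_uniq; rewrite leq_subLR addnC.
apply: (@kneser_lower_bound H s k c s_uniq) => A B AB.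
by have /forallP/(_ B)/implyP := c_proper A; apply.
Qed.

Lemma homomorphic_kneser_bound (T : finType) (F : graph T) (H : hypergraph) k :
  hom_equivalent (kneser H) F -> colorable F k -> altermatic_bound H <= k.
Proof. by case=> HF _ /(homomorphic_colorable HF)/altermatic_bound_leq. Qed.

Section MatchingGraphs.
Variables (T : finType) (G : graph T) (r : nat).
Hypothesis r_gt0 : 0 < r.
Local Notation E := (edge_set G).

(** Colour a matching by one of its edges outside an extremal set F. *)
Lemma matching_graph_colorable : colorable (matching_graph G r) (#|E| - turan_matching G r).
Proof.
have [|F /andP[FE /eqP noM] turF] := @eq_bigmax_cond _
    [pred F : {set {set T}} | (F \subset E) && (matchings r F == set0)] (fun F => #|F|).
  apply/card_gt0P; exists set0; rewrite inE sub0set /=.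
  apply/eqP/setP=> M; rewrite !inE subset0.
  by apply/negP=> /and3P[/eqP-> _ /eqP]; rewrite cards0; move: r_gt0; lia.
rewrite /turan_matching turF -cardsDS //; set k := #|_|.
have color (A : matching_in G r) : exists i : 'I_k, nth set0 (enum (E :\: F)) i \in val A.
  have := valP A; rewrite inE => /and3P[AE trivA cardA].
  have /subsetPn[e eA eF] : ~~ (val A \subset F).
    apply/negP=> AF; have : val A \in matchings r F by rewrite inE AF trivA.
    by rewrite noM inE.
  have eEF : e \in enum (E :\: F) by rewrite mem_enum inE eF (subsetP AE).
  have ik : index e (enum (E :\: F)) < k by rewrite /k cardE index_mem.
  by exists (Ordinal ik); rewrite /= nth_index.
apply/colorableP; exists (fun A => xchoose (color A)) => A B /andP[_ AB].
apply/eqP=> cAB; have iA := xchooseP (color A); have := xchooseP (color B).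
by rewrite -cAB (disjointFr AB iA).
Qed.

(** The hypergraph of the r-matchings must have the edges of G, and nothing else, as
    vertices: isolated vertices would lengthen the alternations. *)
Definition edge_type := {e : {set T} | e \in E}.
Definition matching_edges : {set {set edge_type}} :=
  [set A : {set edge_type} | val @: A \in matchings r E].

Lemma matching_edges_neq0 : set0 \notin matching_edges.
Proof.
rewrite !inE imset0 cards0; apply/negP=> /and3P[_ _ /eqP]; move: r_gt0; lia.
Qed.

Definition matching_hypergraph := Hypergraph matching_edges_neq0.

Lemma matching_hypergraph_equiv :
  hom_equivalent (kneser matching_hypergraph) (matching_graph G r).
Proof.
split.
  have f (A : hyperedge matching_hypergraph) : val @: val A \in matchings r E.
    by have := valP A; rewrite inE.
  exists (fun A => exist (fun M => M \in matchings r E) _ (f A)) => A B AB.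
  have AB' : [disjoint val @: val A & val @: val B].
    by rewrite imset_disjoint //; apply: val_inj.
  apply/andP; split=> //; apply/eqP=> /(congr1 val) /= eqAB.
  move: AB'; rewrite -eqAB -setI_eq0 setIid => /eqP A0.
  by have := f A; rewrite inE A0 cards0 => /and3P[_ _ /eqP]; move: r_gt0; lia.
have g (A : matching_in G r) : val @^-1: val A \in matching_edges.
  have := valP A; rewrite !inE => /and3P[AE trivA cardA].
  suff -> : val @: (val @^-1: val A : {set edge_type}) = val A by rewrite AE trivA.
  apply/setP=> e; apply/imsetP/idP=> [[x]|eA]; first by rewrite inE => xA ->.
  by exists (exist _ e (subsetP AE e eA)); rewrite // inE.
exists (fun A => exist (fun B => B \in matching_edges) _ (g A)) => A B /andP[_ AB].
rewrite /= /kneser_adj /= -setI_eq0 -preimsetI; move: AB; rewrite -setI_eq0 => /eqP->.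
by rewrite preimset0.
Qed.

Lemma card_edge_type : #|{: edge_type}| = #|E|.
Proof. by rewrite card_sig; apply: eq_card => e; rewrite inE. Qed.

Lemma degree_star v : degree G v <= #|star E v|.
Proof.
rewrite /degree -(@card_in_imset _ _ (fun w => [set v; w]) [set w | G v w]); last first.
  move=> w w'; rewrite !inE => vw vw' /setP/(_ w); rewrite !inE eqxx orbT.
  by move/esym/orP=> [/eqP wv|/eqP //]; move: vw; rewrite wv adj_irrefl.
apply: subset_leq_card; apply/subsetP=> e /imsetP[w]; rewrite inE => vw ->.
by rewrite !inE eqxx andbT; apply/imsetP; exists (v, w); rewrite ?inE.
Qed.

(** The sequence X with the entries not selected by m replaced by 0, so that
    positions are kept, unlike in mask m X. *)
Definition masked (m : bitseq) (X : seq sign) : seq sign :=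
  [seq if p.1 then p.2 else None | p <- zip m X].

Lemma pmap_masked m X : size m = size X -> pmap id (masked m X) = pmap id (mask m X).
Proof.
elim: m X => [|b m IHm] [|x X] //= [/IHm E']; rewrite /masked /= -/(masked m X) E'.
by case: b.
Qed.

Lemma alternating_pmap (Y : seq sign) : alternating Y ->
  sorted (@neq bool) (pmap id Y) /\ size (pmap id Y) = size Y.
Proof.
case/andP=> Y0 Ys; have EY : Y = map Some (pmap id Y).
  by elim: Y Y0 {Ys} => //= [[b|]] Y IHY //=; rewrite inE /= => /IHY <-.
split; last by rewrite [in RHS]EY size_map.
by move: Ys; rewrite {1}EY sorted_map.
Qed.

(** The sign that the selected subsequence of X gives to the edge e. *)
Definition coloring (s : seq {set T}) m X e := nth None (masked m X) (index e s).

Lemma pmap_coloring s m X : uniq s -> size m = size s -> size X = size s ->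
  pmap (coloring s m X) s = pmap id (mask m X).
Proof.
move=> s_uniq sm sX; rewrite -pmap_masked ?sm //.
suff -> : masked m X = map (coloring s m X) s.
  by elim: (s) (coloring s m X) => //= e s' IHs c; rewrite -IHs.
apply: (@eq_from_nth _ None); rewrite /masked !size_map size_zip sm sX minnn // => i i_s.
by rewrite (nth_map set0) // /coloring index_uniq.
Qed.

Lemma count_edges (s : seq {set T}) (a : pred {set T}) : uniq s -> s =i E ->
  count a s = #|[set e in E | a e]|.
Proof.
move=> s_uniq sE; rewrite -size_filter -(card_uniqP _) ?filter_uniq //.
by apply: eq_card => e; rewrite mem_filter inE sE andbC.
Qed.

(** The two colour classes of a selected alternating subsequence alternate along s,
    so that [alternating_turan] bounds its length. *)
Lemma alt_matching_ordering (s : seq {set T}) : uniq s -> s =i E ->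
    alternating_bound G (2 * (4 * r * r) + 5 * r) s ->
    (forall v, 9 * r <= #|star E v|) -> r <= #|T| ->
  exists2 t : #|{: edge_type}|.-tuple edge_type, uniq t
    & alt_ordering (H := matching_hypergraph) t <= turan_matching G r.
Proof.
move=> s_uniq sE s_bound degE cardT.
pose ts : seq edge_type := pmap insub s.
have val_ts : map val ts = s.
  rewrite /ts pmap_filter; last exact: insubK.
  by apply/all_filterP/allP=> e; rewrite isSome_insub sE.
have size_ts : size ts == #|{: edge_type}|.
  rewrite card_edge_type -(size_map val) val_ts; apply/eqP.
  by rewrite -(card_uniqP s_uniq); apply: eq_card.
exists (Tuple size_ts) => /=; first by rewrite -(map_inj_uniq val_inj) val_ts.
apply/bigmax_leqP=> X /andP[Xt Xf].
apply/bigmax_leqP=> m alt_m.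
have size_s : size s = #|{: edge_type}| by rewrite -val_ts size_map (eqP size_ts).
have [mX_sorted mX_size] := alternating_pmap alt_m.
have size_m : size m = size s by rewrite !size_tuple.
have size_X : size X = size s by rewrite size_tuple.
pose col := coloring s m X.
have colE : pmap col s = pmap id (mask m X) by apply: pmap_coloring.
have col_sorted : sorted (@neq bool) (pmap col s) by rewrite colE.
pose P b := [set e in E | col e == Some b].
have PE b : P b \subset E by apply/subsetP=> e; rewrite inE => /andP[].
have colX e b : e \in s -> col e = Some b ->
    exists2 j, tnth X j = Some b & val (tnth (Tuple size_ts) j) = e.
  move=> es; rewrite /col /coloring; set i := index e s.
  have i_s : i < size s by rewrite index_mem.
  have i_N : i < #|{: edge_type}| by rewrite -size_s.
  rewrite /masked (nth_map (false, None)) ?size_zip ?size_m ?size_X ?minnn //.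
  rewrite nth_zip ?size_m ?size_X //=; case: ifP => // _ Xi; exists (Ordinal i_N).
    by rewrite (tnth_nth None).
  have e0 : edge_type by exists e; rewrite -sE.
  by rewrite (tnth_nth e0) /= -(nth_map _ set0) ?(eqP size_ts) // val_ts nth_index.
have free b : edge_free (@sign_class matching_hypergraph (Tuple size_ts) X (Some b)) ->
    matchings r (P b) = set0.
  move=> /forall_inP fb; apply/eqP; apply: contraT => /set0Pn[M].
  rewrite inE => /and3P[MP trivM cardM].
  have ME := subset_trans MP (PE b).
  pose B : {set edge_type} := val @^-1: M.
  have valB : val @: B = M.
    apply/setP=> e; apply/imsetP/idP=> [[x]|eM]; first by rewrite inE => xM ->.
    by exists (exist _ e (subsetP ME e eM)); rewrite // inE.
  have BH : B \in matching_edges by rewrite !inE valB ME trivM.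
  case/negP: (fb B BH); apply/subsetP=> x; rewrite inE => xM.
  have := subsetP MP _ xM; rewrite inE -sE => /andP[xs /eqP colx].
  have [j Xj tj] := colX _ _ xs colx; apply/imsetP; exists j; first by rewrite inE Xj.
  by apply: val_inj; rewrite tj.
have size_P : size (mask m X) = #|P true| + #|P false|.
  rewrite -mX_size -colE -!(count_edges _ s_uniq sE) -!count_mem_pmap.
  by elim: (pmap _ _) => //= [[]] l -> /=; rewrite ?addnS.
have pairing b : pairing_bound G (2 * (4 * r * r) + 5 * r) (P b) (P (~~ b)).
  move=> v S vS; have := s_bound col v b S vS col_sorted.
  rewrite !(count_edges _ s_uniq sE).
  have -> : [set e in E | (v \in e) && (col e == Some b)] = star (P b) v.
    by apply/setP=> e; rewrite !inE -andbA [(v \in e) && _]andbC.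
  have -> // : [set e in E | (col e == Some (~~ b)) && [disjoint e & S]]
             = avoiding (P (~~ b)) S.
  by apply/setP=> e; rewrite !inE -andbA.
rewrite size_P; apply: alternating_turan => //.
- rewrite -setI_eq0; apply/eqP/setP=> e; rewrite !inE.
  by case: (col e) => [[]|]; rewrite ?andbF.
- exact: free.
exact: free.
Qed.

End MatchingGraphs.

Import GRing.Theory Num.Theory.

Theorem theorem4 (r : nat) (r_gt0 : 0 < r) :
  exists q m : nat, forall n : nat, m <= n ->
  forall (T : finType) (G : graph T), #|T| = 2 * n ->
  (exists (H : graph T) (U V : {set T}),
     [/\ subgraph H G, bipartition H U V, #|U| = n, #|V| = n
       & (n%:R / 2%:R + q%:R <= (min_degree H)%:R :> rat)%R]) ->
  chromatic_number (matching_graph G r)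
    = #|edge_set G| - turan_matching G r
  /\ is_altermatic_number (matching_graph G r)
       (#|edge_set G| - turan_matching G r).
Proof.
pose R := 2 * (4 * r * r) + 5 * r.
(* R is the margin required by alternating_turan. *)
exists 0, (3000 * (R + 3)) => n n_large T G cardT [H [U [V [HG _ _ _ degH]]]].
have n_deg : n <= 2 * min_degree H.
  move: degH; rewrite addr0 ler_pdivrMr ?ltr0n // -natrM ler_nat mulnC; exact.
have degG v : #|T| <= 4 * degree G v.
  have : min_degree H <= degree H v by apply: geq_bigmin.
  have : degree H v <= degree G v.
    by apply: subset_leq_card; apply/subsetP=> w; rewrite !inE => /HG.
  rewrite cardT; move: n_deg; clear; lia.
have T_large : 3000 * (R + 3) <= #|T| by rewrite cardT; move: n_large; clear; lia.
have starE v : 9 * r <= #|star (edge_set G) v|.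
  apply: leq_trans (degree_star G v); have := degG v; move: T_large; rewrite /R; clear.
  move: (4 * r * r) #|T| (degree G v); lia.
have rT : r <= #|T| by move: T_large; rewrite /R; clear; move: (4 * r * r) #|T|; lia.
have [s [s_uniq sE s_bound]] := alternating_ordering T_large degG.
have [t t_uniq alt_t] := alt_matching_ordering r_gt0 s_uniq sE s_bound starE rT.
have equiv := matching_hypergraph_equiv G r_gt0.
have colE := matching_graph_colorable G r_gt0.
set z := #|_| - _ in colE *.
have zH : altermatic_bound (matching_hypergraph G r_gt0) = z.
  apply/eqP; rewrite eqn_leq (homomorphic_kneser_bound equiv colE) /=.
  rewrite /altermatic_bound /= card_edge_type leq_sub2l //.
  by apply: leq_trans alt_t; apply: geq_bigmin.
split; last first.
  split; first by exists (matching_hypergraph G r_gt0).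
  by move=> K Kequiv; apply: homomorphic_kneser_bound Kequiv colE.
apply/eqP; rewrite eqn_leq chromatic_leq //= -zH.
exact: homomorphic_kneser_bound equiv (colorable_chromatic _).
Qed.
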